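(* Let $\{r_n\}_{n \in \mathbb{N}} \subset \mathbb{N}$ be lacunary. Let $\{t_n\}_{n \in \mathbb{N}} \subset \mathbb{N}$, with $t_1 < t_2 < \cdots$, be such that $\lim_{n \to \infty} t_n/r_n = 0$ and $\{t_n\}_{n\in\mathbb{N}}$ is a set of Bohr recurrence. Then $\{r_n\}_{n \in \mathbb{N}} \cup \{r_n + t_n\}_{n \in \mathbb{N}}$ is a $2$-step interpolation set but not an $I_0$-set.
   Context: $\mathbb{N} = \{1,2,3,\ldots\}$ and $\mathbb{T} = \mathbb{R}/\mathbb{Z}$. A set $\{r_n\}_{n\in\mathbb{N}} \subset \mathbb{N}$ with $r_1 < r_2 < \cdots$ is lacunary if $\inf_{n \in \mathbb{N}} r_{n+1}/r_n > 1$. A Bohr almost periodic sequence is a uniform limit on $\mathbb{N}$ of trigonometric polynomials $n \mapsto \sum_{j=1}^{k} c_j e^{2\pi i n \alpha_j}$ with $c_j \in \mathbb{C}$, $\alpha_j \in \mathbb{R}$. A set $E \subset \mathbb{N}$ is an $I_0$-set if every bounded function $f : E \to \mathbb{C}$ can be extended to a Bohr almost periodic sequence on $\mathbb{N}$. A set $R \subset \mathbb{N}$ is a set of Bohr recurrence if for every finite-dimensional torus $\mathbb{T}^d$ and every $\alpha \in \mathbb{T}^d$, the point $0$ is in the closure of $\{n\alpha : n \in R\}$. Let $G$ be a $k$-step nilpotent Lie group (its $(k+1)$-st lower central subgroup is trivial) and $\Gamma \subset G$ a discrete cocompact subgroup; let $X = G/\Gamma$. For $g \in G$, $x \in X$ and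 $F : X \to \mathbb{C}$ continuous, the sequence $(F(g^n x))_{n \in \mathbb{N}}$ is called a basic $k$-step nilsequence. A $k$-step nilsequence is a uniform limit on $\mathbb{N}$ of basic $k$-step nilsequences. A set $E \subset \mathbb{N}$ is a $k$-step interpolation set if for every bounded function $f : E \to \mathbb{C}$ there is a $k$-step nilsequence $\psi : \mathbb{N} \to \mathbb{C}$ with $\psi(n) = f(n)$ for all $n \in E$. *)

(* Defs.v *)
From HB Require Import structures.
From mathcomp Require Import all_boot all_order all_algebra.
From mathcomp Require Import all_classical all_reals all_analysis.
From mathcomp Require Import generic_quotient ring_quotient.
From mathcomp Require Import complex.

Set Implicit Arguments.
Unset Strict Implicit.
Unset Printing Implicit Defensive.

Import Order.TTheory GRing.Theory Num.Theory.
Import numFieldNormedType.Exports.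

Local Open Scope classical_set_scope.
Local Open Scope ring_scope.
Local Open Scope quotient_scope.

(* [R[i]] gets its usual topology from the instances that MathComp-Analysis
   declares for every [numClosedFieldType]. *)
Definition Cplx (R : realType) : numClosedFieldType := R[i]%C.

Definition cexp2pi (R : realType) (x : R) : Cplx R :=
  (cos (2 * trigo.pi * x) +i* sin (2 * trigo.pi * x))%C.

(* Sequences (r_n) with n >= 1 are re-indexed from 0. *)
Definition lacunary (R : realType) (r : nat -> nat) : Prop :=
  (forall n, (r n < r n.+1)%N) /\
  1 < inf (range (fun n => (r n.+1)%:R / (r n)%:R : R)).

(* Sequences indexed by {1, 2, ...} are functions on [nat] whose value at 0 is
   ignored. *)
Definition uniform_limit_of (R : realType) (S : set (nat -> Cplx R))
    (psi : nat -> Cplx R) : Prop :=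
  exists p : nat -> nat -> Cplx R,
    (forall m, S (p m)) /\ {uniform [set n | (0 < n)%N], p @ \oo --> psi}.

Definition interpolates (R : realType) (S : set (nat -> Cplx R))
    (E : set nat) : Prop :=
  forall f : nat -> Cplx R, [bounded f n | n in E] ->
    exists2 psi, S psi & forall n, E n -> psi n = f n.

Definition trig_poly (R : realType) (p : nat -> Cplx R) : Prop :=
  exists k (c : 'I_k -> Cplx R) (alpha : 'I_k -> R),
    forall n, (0 < n)%N -> p n = \sum_(j < k) c j * cexp2pi (n%:R * alpha j).

Definition bohr_almost_periodic (R : realType) : set (nat -> Cplx R) :=
  uniform_limit_of (@trig_poly R).

Definition I0_set (R : realType) (E : set nat) : Prop :=
  interpolates (@bohr_almost_periodic R) E.

(* [Num.int] as a closed predicate, so that [Quotient.quot] below is R/Z. *)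
Definition integers (R : realType) : zmodClosed R :=
  GRing.ZmodClosed.clone R (@Num.int_num_subdef R) _.

Definition circle (R : realType) : Type :=
  quotient_topology (Quotient.quot (integers R)).
HB.instance Definition _ (R : realType) := Topological.on (circle R).
HB.instance Definition _ (R : realType) := GRing.isZmodule.Build (circle R)
  (@Quotient.addqA R (integers R)) (@Quotient.addqC R (integers R))
  (@Quotient.add0q R (integers R)) (@Quotient.addNq R (integers R)).

Definition bohr_recurrence (R : realType) (A : set nat) : Prop :=
  forall d (alpha : 'rV[circle R]_d),
    closure [set alpha *+ n | n in A] 0.

(* Only meant for open [U]: derivatives of [f] at points of [U] are taken in the
   whole space, and the values of [f] outside [U] do not matter. *)
Fixpoint Ck_on (R : realType) (V W : normedModType R) (k : nat) (U : set V)
    (f : V -> W) : Prop :=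
  if k is k'.+1 then
    (forall x, U x -> differentiable f x) /\
    (forall v, Ck_on k' U (fun x => 'D_v f x))
  else forall x, U x -> {for x, continuous f}.

Definition smooth_on (R : realType) (V W : normedModType R) (U : set V)
    (f : V -> W) : Prop := forall k, Ck_on k U f.

#[short(type="groupTopologicalType")]
HB.structure Definition GroupTopological := {G of Group G & Topological G}.

(* A chart of G in R^n: a homeomorphism from the open set [chart_dom] onto an
   open subset of R^n, given together with its inverse; both functions carry no
   information outside these two open sets. *)
Record chart (R : realType) (n : nat) (G : topologicalType) := Chart {
  chart_dom : set G ;
  chart_map : G -> 'rV[R]_n ;
  chart_inv : 'rV[R]_n -> G ;
  chart_dom_open : open chart_dom ;
  chart_img_open : open (chart_map @` chart_dom) ;
  chart_mapK : forall x, chart_dom x -> chart_inv (chart_map x) = x ;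
  chart_map_cont : {within chart_dom, continuous chart_map} ;
  chart_inv_cont : {within chart_map @` chart_dom, continuous chart_inv} }.

(* [A] is an atlas, not necessarily maximal, making G a Lie group of dimension n;
   manifolds are taken to be Hausdorff and second countable. *)
Record lie_group (R : realType) (n : nat) (G : groupTopologicalType)
    (A : set (chart R n G)) : Prop := {
  lie_hausdorff : hausdorff_space G ;
  lie_second_countable : @second_countable G ;
  lie_mul_cont : continuous (fun p : G * G => (p.1 * p.2)%g) ;
  lie_inv_cont : continuous (fun x : G => x^-1%g) ;
  lie_cover : forall x : G, exists2 c, A c & chart_dom c x ;
  lie_compat : forall c1 c2, A c1 -> A c2 ->
    smooth_on (chart_map c1 @` (chart_dom c1 `&` chart_dom c2))
      (chart_map c2 \o chart_inv c1) ;
  lie_mul_smooth : forall c1 c2 c3, A c1 -> A c2 -> A c3 ->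
    smooth_on
      [set p : 'rV[R]_n * 'rV[R]_n |
        [/\ (chart_map c1 @` chart_dom c1) p.1,
            (chart_map c2 @` chart_dom c2) p.2 &
            chart_dom c3 (chart_inv c1 p.1 * chart_inv c2 p.2)%g]]
      (fun p => chart_map c3 (chart_inv c1 p.1 * chart_inv c2 p.2)%g) ;
  lie_inv_smooth : forall c1 c2, A c1 -> A c2 ->
    smooth_on
      [set u | (chart_map c1 @` chart_dom c1) u /\
               chart_dom c2 (chart_inv c1 u)^-1%g]
      (fun u => chart_map c2 (chart_inv c1 u)^-1%g) }.

Definition is_subgroup (G : groupType) (H : set G) : Prop :=
  H 1%g /\ forall x y, H x -> H y -> H (x / y)%g.

(* [lower_central G j] is the (j+1)-st lower central subgroup. *)
Fixpoint lower_central (G : groupType) (j : nat) : set G :=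
  if j is j'.+1 then
    smallest (@is_subgroup G)
      [set z | exists x y : G, lower_central j' x /\ z = [~ x, y]%g]
  else setT.

Definition nilpotent_of_step (k : nat) (G : groupType) : Prop :=
  lower_central (G := G) k = [set 1%g].

Section Cosets.
Variables (G : groupTopologicalType) (Gamma : groupClosed G).

Definition same_coset (x y : G) : bool := (x^-1 * y)%g \in Gamma.

Lemma same_coset_is_equiv : equiv_class_of same_coset.
Proof.
split=> [x|x y|y x z]; rewrite /same_coset.
- by rewrite mulVg; exact: gpred1.
- by rewrite -[LHS]gpredV invgM invgK.
- move=> xy yz; suff -> : (x^-1 * z = (x^-1 * y) * (y^-1 * z))%g.
    exact: gpredM.
  by rewrite mulgA mulgK.
Qed.

Canonical same_coset_equiv := EquivRelPack same_coset_is_equiv.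
Canonical same_coset_encModRel := defaultEncModRel same_coset.

Definition coset_space : Type := quotient_topology {eq_quot same_coset}.

(* The left translation hGamma |-> ghGamma, computed on a representative. *)
Definition coset_act (g : G) (x : coset_space) : coset_space :=
  \pi_coset_space (g * repr x)%g.
End Cosets.

Definition basic_nilsequence (R : realType) (k : nat)
    (psi : nat -> Cplx R) : Prop :=
  exists (n : nat) (G : groupTopologicalType) (A : set (chart R n G))
         (Gamma : groupClosed G),
    [/\ lie_group A,
        nilpotent_of_step k G,
        (forall x, x \in Gamma -> isolated [set` Gamma] x),
        compact [set: coset_space Gamma] &
        exists (g : G) (x : coset_space Gamma)
               (F : coset_space Gamma -> Cplx R),
          continuous F /\
          forall m, (0 < m)%N -> psi m = F (coset_act (g ^+ m)%g x)].

Definition nilsequence (R : realType) (k : nat) : set (nat -> Cplx R) :=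
  uniform_limit_of (@basic_nilsequence R k).

Definition interpolation_set (R : realType) (k : nat) (E : set nat) : Prop :=
  interpolates (@nilsequence R k) E.

(* Main.v *)
From HB Require Import structures.
Require Import Defs.
From mathcomp Require Import all_boot all_order all_algebra.
From mathcomp Require Import all_classical all_reals all_analysis.
From mathcomp Require Import zify ring lra.
From mathcomp Require Import complex generic_quotient ring_quotient.

(** Write E for the set of all r_n and r_n + t_n, and let x -> dist_int x be the
distance to the nearest integer.

Interpolation.  The sequences k -> F (k a, k^2 b, ...), with F continuous on a
torus, form an algebra of two-step nilsequences ([torus_sequence]): k a and
k^2 b are coordinates of the orbit of a unipotent affine map of a torus, and a
torus with such a map is a quotient of the group Z |x R^n, on which Z acts by
unipotent integer matrices ([basic_nilsequence_torus]).  As in the proof of the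
Tietze extension theorem, it suffices to separate any two disjoint subsets A, B
of E, that is to find a sequence of the algebra equal to 0 on A and to 1 on B
([torus_separated], [torus_interpolation]).  Separation is inherited by finite
unions in both arguments, so A and B may be cut into finitely many pieces, and
lacunarity makes each piece as sparse as desired.

The tool that separates is [sparse_phase]: if the elements of a set of positive
integers grow by a factor 5, then a single real number a makes all the x a,
x in the set, close modulo 1 to prescribed targets.  It separates A from B at
once when A and B together are sparse.  If A and B are only sparse separately,
each a in A has at most one neighbour b in B within a factor 5, and the
resulting matched pairs are the obstruction.  It is enough to have a phase phi
with phi a - phi b far from the integers for all matched pairs: after cutting A
according to the value of phi modulo 1, the pairs inside one piece are separated
by phi, and different pieces contain no pair ([torus_separated_by_phase]).
There are two kinds of matched pairs in E.
- If |a - b| is comparable to a, the differences |a - b| are again sparse, and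
  [sparse_phase] yields a linear phase phi k = k x ([torus_separated_linear]).
- Otherwise the pair is (r_n, r_n + t_n), and linear phases may fail.  But
  (r_n + t_n)^2 - r_n^2 = t_n (2 r_n + t_n) is sparse, since t_n increases;
  hence a quadratic phase phi k = k^2 x works
  ([torus_separated_square]).

Failure of Bohr almost periodic interpolation.  Let f be 1 at the r_n and 0
elsewhere.  For a trigonometric polynomial p close to an extension of f, Bohr
recurrence gives n such that t_n is almost a period of every frequency of p, and
n may be taken large because adding the frequencies 1/(2 t_i) rules out any
given t_i.  Then p (r_n + t_n) is close to p (r_n), although the values of f are
0 and 1 ([not_I0_shifted]). *)

Set Implicit Arguments.
Unset Strict Implicit.
Unset Printing Implicit Defensive.

Import Order.TTheory GRing.Theory Num.Theory.
Import numFieldNormedType.Exports.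

Local Open Scope classical_set_scope.
Local Open Scope ring_scope.

(** * The distance to the nearest integer, and prescribing phases along a sparse set *)

Definition dist_int (R : realType) (x : R) : R :=
  `|x - (Num.floor (x + 2^-1))%:~R|.

Lemma dist_int_ge0 (R : realType) (x : R) : 0 <= dist_int x.
Proof. exact: normr_ge0. Qed.

Lemma dist_int_le_half (R : realType) (x : R) : dist_int x <= 2^-1.
Proof.
rewrite /dist_int; have /andP[] := floor_itv (x + 2^-1).
rewrite intrD => h1 h2; rewrite ler_norml; apply/andP; split; lra.
Qed.

Lemma dist_int_le (R : realType) (x : R) (z : int) :
  dist_int x <= `|x - z%:~R|.
Proof.
have := dist_int_le_half x; rewrite /dist_int; set m := Num.floor _.
have [->//|zm] := eqVneq z m; move=> h.
have : 1 <= `|(m - z)%:~R : R|.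
  rewrite -intr_norm -[1]/(1%:~R) ler_int; lia.
rewrite intrB; have -> : m%:~R - z%:~R = (x - z%:~R) - (x - m%:~R) :> R by ring.
move=> /le_trans/(_ (ler_normB _ _)); lra.
Qed.

Lemma dist_intDz (R : realType) (x : R) (z : int) :
  dist_int (x + z%:~R) = dist_int x.
Proof.
suff h y (n : int) : dist_int (y + n%:~R) <= dist_int y :> R.
  apply/eqP; rewrite eq_le h /=.
  by have := h (x + z%:~R) (- z); rewrite mulrNz addrK.
rewrite {2}/dist_int; set m := Num.floor _.
apply: le_trans (dist_int_le _ (m + n)) _.
by rewrite intrD opprD addrACA subrr addr0.
Qed.

Lemma dist_int_lip (R : realType) (x y : R) :
  dist_int x <= dist_int y + `|x - y|.
Proof.
rewrite {2}/dist_int; set m := Num.floor _.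
apply: le_trans (dist_int_le _ m) _.
have -> : x - m%:~R = (y - m%:~R) + (x - y) by ring.
exact: ler_normD.
Qed.

Lemma dist_intN (R : realType) (x : R) : dist_int (- x) = dist_int x.
Proof.
suff h y : dist_int (- y) <= dist_int y :> R.
  by apply/eqP; rewrite eq_le h /= -{1}[x]opprK h.
rewrite {2}/dist_int; set m := Num.floor _.
apply: le_trans (dist_int_le _ (- m)) _.
by rewrite mulrNz -opprD normrN.
Qed.

Lemma dist_int_half (R : realType) : dist_int (2^-1 : R) = 2^-1.
Proof.
apply/eqP; rewrite eq_le dist_int_le_half /=.
rewrite /dist_int; set m := Num.floor _.
have [m0|m1] := lerP m 0.
  have : (m%:~R : R) <= 0 by rewrite -[0]/(0%:~R) ler_int.
  move=> h; rewrite ger0_norm; lra.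
have : 1 <= (m%:~R : R) by rewrite -[1]/(1%:~R) ler_int; lia.
move=> h; rewrite ler0_norm; lra.
Qed.

Lemma dist_int_triangle (R : realType) (x y : R) :
  dist_int (x + y) <= dist_int x + dist_int y.
Proof.
rewrite {2 3}/dist_int; set m := Num.floor _; set n := Num.floor _.
apply: le_trans (dist_int_le _ (m + n)) _.
have -> : x + y - (m + n)%:~R = (x - m%:~R) + (y - n%:~R) by rewrite intrD; ring.
exact: ler_normD.
Qed.

Lemma dist_int_continuous (R : realType) : continuous (@dist_int R).
Proof.
move=> x; apply/cvgrPdist_le => /= e e0; near=> y.
have xy : `|x - y| <= e by near: y; exact: cvgr_dist_le.
have h1 := dist_int_lip x y; have := dist_int_lip y x; rewrite distrC => h2.
rewrite ler_norml; apply/andP; split; lra.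
Unshelve. all: by end_near. Qed.

(** Moving a to the nearest solution of k b = th modulo 1 costs at most half the
spacing 1/k of these solutions. *)
Lemma phase_near (R : realType) (k : nat) (a th : R) : (0 < k)%N ->
  exists b, dist_int (k%:R * b - th) = 0 /\ `|b - a| <= (2 * k%:R)^-1.
Proof.
move=> k0; have kR : 0 < k%:R :> R by rewrite ltr0n.
pose m := Num.floor (k%:R * a - th + 2^-1).
exists ((m%:~R + th) / k%:R); split.
  rewrite mulrCA divff ?gt_eqF// mulr1 addrK -[m%:~R]add0r dist_intDz.
  apply/eqP; rewrite eq_le dist_int_ge0 andbT.
  by apply: le_trans (dist_int_le _ 0) _; rewrite subrr normr0.
have := dist_int_le_half (k%:R * a - th); rewrite /dist_int -/m => h.
have -> : (m%:~R + th) / k%:R - a = - (k%:R * a - th - m%:~R) / k%:R.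
  by field; rewrite gt_eqF.
rewrite normrM normrN normfV (gtr0_norm kR) invfM.
by rewrite ler_pM2r ?invr_gt0.
Qed.

Definition sparse (L : nat) (X : set nat) : Prop :=
  forall x y, X x -> X y -> (x < y)%N -> (L * x <= y)%N.

(** The balls of centre c n and radius w n decrease: both the correction of the
phase in [sparse_phase] and the partial sums in [torus_interpolation] are
controlled in this form. *)
Lemma nested_balls (R : realType) (c w : nat -> R) :
  (forall n, 0 <= w n) -> (forall n, `|c n.+1 - c n| <= w n - w n.+1) ->
  exists x, forall n, `|x - c n| <= w n.
Proof.
move=> w0 cw; pose lo n := c n - w n; pose hi n := c n + w n.
have step n : lo n <= lo n.+1 /\ hi n.+1 <= hi n.
  by have := cw n; rewrite /lo /hi ler_norml => /andP[h1 h2]; split; lra.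
have lo_mono : {homo lo : m n / (m <= n)%N >-> m <= n}.
  by apply: homo_leq => [x|y x z|n]; [exact: lexx|exact: le_trans|have [] := step n].
have hi_mono : {homo hi : m n / (m <= n)%N >-> n <= m}.
  by apply: (@homo_leq _ hi (fun x y => y <= x)) => [x|y x z h1 h2|n];
    [exact: lexx|exact: le_trans h1|have [] := step n].
have lohi m n : lo m <= hi n.
  apply: le_trans (lo_mono _ _ (leq_maxl m n)) _.
  apply: le_trans (hi_mono _ _ (leq_maxr m n)).
  by rewrite /lo /hi; have := w0 (maxn m n) => h; lra.
exists (sup (range lo)) => n.
have h1 : lo n <= sup (range lo).
  by apply: ub_le_sup; [exists (hi 0) => _ [m _ <-]|exists n].
have h2 : sup (range lo) <= hi n.
  by apply: ge_sup; [exists (lo 0), 0%N|move=> _ [m _ <-]].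
by move: h1 h2; rewrite /lo /hi ler_norml => h1 h2; apply/andP; split; lra.
Qed.

(** Run through the integers, and at each x in X move the current value a by at
most 1/(2x) so that x a is exactly on target.  As X grows by a factor 5, all the
later moves together amount to at most 1/(8x), hence change x a by at most
1/8. *)
Lemma sparse_phase (R : realType) (X : set nat) (th : nat -> R) :
  (forall x, X x -> (0 < x)%N) -> sparse 5 X ->
  exists a : R, forall x, X x -> dist_int (x%:R * a - th x) <= 8^-1.
Proof.
move=> X0 Xs.
have [nxt nxtP] : exists nxt : nat -> R -> R, forall k a, (0 < k)%N ->
    dist_int (k%:R * nxt k a - th k) = 0 /\
    `|nxt k a - a| <= (2 * k%:R)^-1.
  have /choice[g gP] : forall ka : nat * R, exists b, (0 < ka.1)%N ->
      dist_int (ka.1%:R * b - th ka.1) = 0 /\ `|b - ka.2| <= (2 * ka.1%:R)^-1.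
    move=> [k a] /=; have [k0|] := boolP (0 < k)%N; last by exists 0.
    by have [b] := phase_near a (th k) k0; exists b.
  by exists (fun k a => g (k, a)) => k a; exact: (gP (k, a)).
(* [st k] is the value of a before k is processed, with 8 times the radius that
   the later moves may use up: 1 over the last element of X met so far, and 5
   at the start, which leaves room for a move at 1. *)
pose st := fix st k : R * R := if k is k'.+1 then
  if `[< X k' >] then (nxt k' (st k').1, k'%:R^-1) else st k' else (0, 5).
have w_ge0 k : 0 <= (st k).2.
  by elim: k => [|k IH] //=; case: ifP => // _; rewrite invr_ge0.
have wX k : forall y, X y -> (k <= y)%N -> 5 * y%:R^-1 <= (st k).2.
  elim: k => [|k IH] y Xy ky.
    rewrite /= -[leRHS]mulr1 ler_pM2l//.
    by rewrite invf_le1 ?ltr0n ?ler1n ?X0.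
  rewrite /=; case: asboolP => [Xk|_]; last exact: IH (ltnW ky).
  have k0 := X0 _ Xk; have y0 := X0 _ Xy.
  rewrite /= ler_pdivrMr ?ltr0n// mulrC ler_pdivlMr ?ltr0n//.
  by rewrite -natrM ler_nat Xs.
have [a aP] : exists a, forall k, `|a - (st k).1| <= (st k).2 / 8.
  apply: nested_balls => k; first by rewrite divr_ge0.
  rewrite /=; case: asboolP => [Xk|_] /=; last by rewrite !subrr normr0.
  have [_] := nxtP k (st k).1 (X0 _ Xk); have := wX k k Xk (leqnn _).
  by rewrite invfM; set v := k%:R^-1 => h1 h2; lra.
exists a => x Xx.
have := aP x.+1; rewrite /=; case: asboolP => // _ /=.
have [e0 _] := nxtP x (st x).1 (X0 _ Xx); set b := nxt _ _ in e0 * => ab.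
apply: le_trans (dist_int_lip _ (x%:R * b - th x)) _.
rewrite e0 add0r.
have -> : x%:R * a - th x - (x%:R * b - th x) = x%:R * (a - b) by ring.
have xR : 0 < x%:R :> R by rewrite ltr0n X0.
by rewrite normrM gtr0_norm// -ler_pdivlMl// mulrC.
Qed.

(** * Topology and calculus of finite-dimensional row vectors *)

Lemma mx_continuous (U V : topologicalType) m n (f : U -> 'M[V]_(m, n)) :
  (forall i j, continuous (fun x => f x i j)) -> continuous f.
Proof.
move=> fc x A [P MP sPA]; rewrite /nbhs /=.
have : \forall y \near x, forall ij : 'I_m * 'I_n, P ij.1 ij.2 (f y ij.1 ij.2).
  by apply: filter_forall => -[i j] /=; apply: fc; exact: MP.
apply: filterS => y Py; apply: sPA => i j; exact: (Py (i, j)).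
Qed.

Lemma pair_continuous (U V W : topologicalType) (f : U -> V) (g : U -> W) :
  continuous f -> continuous g -> continuous (fun x => (f x, g x)).
Proof. by move=> fc gc x; apply: cvg_pair; [exact: fc|exact: gc]. Qed.

Lemma prod_hausdorff (S T : topologicalType) :
  hausdorff_space S -> hausdorff_space T -> hausdorff_space (S * T)%type.
Proof.
move=> hS hT [a b] [c d] cl; congr (_, _).
  apply: hS => A B nA nB.
  have [||[x y] [[/= Ax _] [/= Bx _]]] := cl (A `*` setT) (B `*` setT).
  - by exists (A, setT) => //=; split => //; exact: filterT.
  - by exists (B, setT) => //=; split => //; exact: filterT.
  by exists x.
apply: hT => A B nA nB.
have [||[x y] [[/= _ Ay] [/= _ By]]] := cl (setT `*` A) (setT `*` B).
- by exists (setT, A) => //=; split => //; exact: filterT.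
- by exists (setT, B) => //=; split => //; exact: filterT.
by exists y.
Qed.

Lemma mulmx_continuous (R : realType) n (N : 'M[R]_n) :
  continuous (fun v : 'rV[R]_n => v *m N).
Proof.
apply: mx_continuous => i j.
have -> : (fun v : 'rV[R]_n => (v *m N) i j) = fun v => \sum_k v i k * N k j.
  by apply/funext => v; rewrite mxE.
move=> v; apply: (cvg_big (@add_continuous R) (nbhs_filter v)) => k _.
by apply: cvgM; [exact: coord_continuous|exact: cvg_cst].
Qed.

Lemma cvg_mulmx (R : realType) n (N : 'M[R]_n) (T : Type) (F : set_system T)
    (f : T -> 'rV[R]_n) (v : 'rV[R]_n) :
  f @ F --> v -> (fun z => f z *m N) @ F --> v *m N.
Proof. by move=> fv; exact: (cvg_comp _ _ fv (@mulmx_continuous R n N v)). Qed.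

Lemma Ck_on_cst (R : realType) (V W : normedModType R) k (U : set V) (c : W) :
  Ck_on k U (fun=> c).
Proof.
elim: k c => [|k IH] c /=; first by move=> x _; exact: cst_continuous.
split=> [x _|v]; first exact: differentiable_cst.
have -> : (fun x => 'D_v (fun=> c : W) x) = fun=> 0 :> W.
  by apply/funext => x; exact: derive_cst.
exact: IH.
Qed.

Lemma smooth_on_linear (R : realType) (V W : normedModType R) (U : set V)
    (f : V -> W) : linear f -> continuous f -> smooth_on U f.
Proof.
move=> lf cf.
pose F : {linear V -> W} := HB.pack f (GRing.isLinear.Build R V W *:%R f lf).
have dF x : differentiable f x by exact: (@linear_differentiable _ _ _ F x cf).
case=> [|k] /=; first by move=> x _; exact: cf.
split=> [x _|v]; first exact: dF.
have -> : (fun x => 'D_v f x) = fun=> f v; last exact: Ck_on_cst.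
by apply/funext => x; rewrite deriveE// (@diff_lin _ _ _ F x (cf)).
Qed.

(** Products of a point of Z and an open box with rational corners form a
basis. *)
Lemma second_countable_prod_row (R : realType) n :
  @second_countable (discrete_topology int * 'rV[R]_n)%type.
Proof.
pose box (mab : int * ('rV[rat]_n * 'rV[rat]_n)) :=
  [set x : discrete_topology int * 'rV[R]_n | x.1 = mab.1 /\
    forall j, ratr (mab.2.1 0 j) < x.2 0 j < ratr (mab.2.2 0 j)].
exists (range box); first exact: sub_countable (card_image_le _ _) _.
have box_open mab : open (box mab).
  rewrite openE => -[m v] [/= mE vE].
  exists ([set m], [set v : 'rV[R]_n | forall j,
    ratr (mab.2.1 0 j) < v 0 j < ratr (mab.2.2 0 j)]) => /=.
    split; first exact: discrete_set1.
    exists (fun _ j => [set x : R | ratr (mab.2.1 0 j) < x < ratr (mab.2.2 0 j)]).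
      move=> i j /=; rewrite (ord1 i); 
      have vj : v 0 j \in `]ratr (mab.2.1 0 j), ratr (mab.2.2 0 j)[.
        by rewrite in_itv /= vE.
      by apply: filterS (near_in_itvoo vj) => x; rewrite in_itv.
    by move=> w /= wP j; exact: wP.
  by move=> [m' w] [/= -> wP]; split.
split; first by move=> _ [mab _ <-].
move=> [m v] A [[A1 A2] /= [mA1 [P vP PA2]] AA].
have /choice[ab abP] : forall j, exists ab : rat * rat,
    ratr ab.1 < v 0 j < ratr ab.2 /\
    [set x : R | ratr ab.1 < x < ratr ab.2] `<=` P 0 j.
  move=> j; have := vP 0 j => /nbhs_ballP[e /= e0 eP].
  have [|a] := @rat_in_itvoo R (v 0 j - e) (v 0 j); first lra.
  rewrite in_itv /= => /andP[a1 a2].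
  have [|b] := @rat_in_itvoo R (v 0 j) (v 0 j + e); first lra.
  rewrite in_itv /= => /andP[b1 b2].
  exists (a, b); split; first by rewrite a2 b1.
  move=> x /= /andP[ax xb]; apply: eP.
  by rewrite -ball_normE /= ltr_norml; apply/andP; split; lra.
exists (box (m : int, (\row_j (ab j).1, \row_j (ab j).2))).
  split; first by exists (m : int, (\row_j (ab j).1, \row_j (ab j).2)).
  by split => //= j; rewrite !mxE; have [] := abP j.
move=> [m' w] [/= -> wP]; apply: AA; split => /=; first exact: nbhs_singleton.
apply: PA2 => i j; rewrite (ord1 i); have [_] := abP j; apply => /=.
by have := wP j; rewrite !mxE.
Qed.

(** * Two-step sequences on tori, and the separation of sets of integers by them *)

(** The R^n-component of the k-th power of (1, v) in the group [shear_group]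
below. *)
Definition unipotent_orbit (R : realType) n (N : 'M[R]_n) (v : 'rV[R]_n)
  (k : nat) : 'rV[R]_n := k%:R *: v + 'C(k, 2)%:R *: (v *m N).

(** A continuous function on a torus is encoded as a Z^n-periodic function F of
row vectors.  The matrix N is part of the data, so that two such sequences can
be combined by a block-diagonal matrix. *)
Definition torus_sequence (R : realType) (T : topologicalType)
    (psi : nat -> T) : Prop :=
  exists n (N : 'M[R]_n) (v : 'rV[R]_n) (F : 'rV[R]_n -> T),
    [/\ N *m N = 0, forall i j, N i j \is a Num.int, continuous F,
        forall x z : 'rV[R]_n, (forall j, z 0 j \is a Num.int) -> F (x + z) = F x &
        forall k, psi k = F (unipotent_orbit N v k)].

Lemma torus_sequence_comp2 (R : realType) (T1 T2 T3 : topologicalType)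
    (H : T1 * T2 -> T3) (psi1 : nat -> T1) (psi2 : nat -> T2) :
  continuous H -> torus_sequence R psi1 -> torus_sequence R psi2 ->
  torus_sequence R (fun k => H (psi1 k, psi2 k)).
Proof.
move=> Hc [n1 [N1 [v1 [F1 [NN1 iN1 cF1 pF1 E1]]]]].
move=> [n2 [N2 [v2 [F2 [NN2 iN2 cF2 pF2 E2]]]]].
exists (n1 + n2)%N, (block_mx N1 0 0 N2), (row_mx v1 v2).
exists (fun x => H (F1 (lsubmx x), F2 (rsubmx x))); split.
- by rewrite mulmx_block !mulmx0 !mul0mx !addr0 !add0r NN1 NN2 block_mx0.
- move=> i j; rewrite -(splitK i) -(splitK j).
  case: (fintype.split i) => i'; case: (fintype.split j) => j' /=;
  by rewrite ?block_mxEul ?block_mxEur ?block_mxEdl ?block_mxEdr ?mxE.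
- have lc : continuous (@lsubmx R 1 n1 n2).
    apply: mx_continuous => i j.
    have -> : (fun x : 'rV[R]_(n1 + n2) => lsubmx x i j) =
        fun x => x i (lshift n2 j).
      by apply/funext => x; rewrite mxE.
    exact: coord_continuous.
  have rc : continuous (@rsubmx R 1 n1 n2).
    apply: mx_continuous => i j.
    have -> : (fun x : 'rV[R]_(n1 + n2) => rsubmx x i j) =
        fun x => x i (rshift n1 j).
      by apply/funext => x; rewrite mxE.
    exact: coord_continuous.
  move=> x; apply: (@continuous_comp _ _ _ (fun x => (F1 (lsubmx x), F2 (rsubmx x))) H);
    last exact: Hc.
  apply: pair_continuous => y.
    exact: (@continuous_comp _ _ _ (@lsubmx R 1 n1 n2) F1 y (lc y) (cF1 _)).
  exact: (@continuous_comp _ _ _ (@rsubmx R 1 n1 n2) F2 y (rc y) (cF2 _)).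
- move=> x z zi; rewrite !linearD /= pF1 ?pF2//.
    by move=> j; rewrite mxE.
  by move=> j; rewrite mxE.
- move=> k; rewrite E1 E2 /unipotent_orbit mul_row_block !mulmx0 addr0 add0r.
  by rewrite !scale_row_mx add_row_mx row_mxKl row_mxKr.
Qed.

Lemma torus_sequence_cst (R : realType) (T : topologicalType) (c : T) :
  torus_sequence R (fun=> c).
Proof.
exists 0, 0, 0, (fun=> c); split => //.
- by rewrite mulmx0.
- by move=> i j; rewrite mxE.
- exact: cst_continuous.
Qed.

Lemma torus_sequence_comp (R : realType) (T1 T2 : topologicalType)
    (H : T1 -> T2) (psi : nat -> T1) :
  continuous H -> torus_sequence R psi -> torus_sequence R (H \o psi).
Proof.
move=> Hc hp.
apply: (@torus_sequence_comp2 R T1 T1 T2 (H \o fst) psi psi) => //.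
by move=> x; apply: continuous_comp; [exact: cvg_fst|exact: Hc].
Qed.

Lemma dist_int_coord_continuous (R : realType) n (j : 'I_n) (b : R) :
  continuous (fun x : 'rV[R]_n => dist_int (x 0 j + b)).
Proof.
move=> x; have h : {for x, continuous (fun x : 'rV[R]_n => x 0 j + b)}.
  by apply: continuousD; [exact: coord_continuous|exact: cst_continuous].
exact: continuous_comp h (@dist_int_continuous R _).
Qed.

Lemma torus_sequence_linear (R : realType) (a b : R) :
  torus_sequence R (fun k => dist_int (k%:R * a + b)).
Proof.
exists 1, 0, (const_mx a), (fun x : 'rV_1 => dist_int (x 0 0 + b)); split.
- by rewrite mulmx0.
- by move=> i j; rewrite mxE.
- exact: dist_int_coord_continuous.
- move=> x z zi; rewrite mxE addrAC; have /intrP[m ->] := zi 0.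
  exact: dist_intDz.
- by move=> k; rewrite /unipotent_orbit !mulmx0 scaler0 addr0 !mxE.
Qed.

(** With N sending the first basis vector to the second, the second coordinate
of the orbit of (2a, a) is C(k, 2) 2a + k a = k^2 a. *)
Lemma torus_sequence_square (R : realType) (a b : R) :
  torus_sequence R (fun k => dist_int ((k ^ 2)%:R * a + b)).
Proof.
pose v : 'rV[R]_2 := \row_j (if j == 0 then 2 * a else a).
exists 2, (delta_mx 0 1), v, (fun x : 'rV_2 => dist_int (x 0 1 + b)); split.
- by rewrite mul_delta_mx_0.
- by move=> i j; rewrite mxE; case: (_ && _).
- exact: dist_int_coord_continuous.
- move=> x z zi; rewrite mxE addrAC; have /intrP[m ->] := zi 1.
  exact: dist_intDz.
- move=> k; congr (dist_int (_ + b)).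
  rewrite /unipotent_orbit !mxE big_ord_recl big_ord1 !mxE /=.
  rewrite mulr0 addr0 mulr1 mulrA -mulrDl -natrM -natrD; congr (_%:R * a).
  rewrite muln2 bin2 -mul2n; case: k => // k.
  by rewrite /= mul2n halfK oddM /= andNb subn0; lia.
Qed.

(** The values are pinned to 0 and 1 for convenience; by [torus_separated_level]
a strict gap between two levels is enough. *)
Definition torus_separated (R : realType) (A B : set nat) : Prop :=
  exists psi : nat -> R, [/\ torus_sequence R psi,
    forall k, 0 <= psi k <= 1, forall k, A k -> psi k = 0 &
    forall k, B k -> psi k = 1].

Lemma torus_separated_level (R : realType) (A B : set nat) (psi : nat -> R) (a b : R) :
  torus_sequence R psi -> a < b -> (forall k, A k -> psi k <= a) ->
  (forall k, B k -> b <= psi k) -> torus_separated R A B.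
Proof.
move=> hpsi ab hA hB.
pose H (x : R) : R := Num.max 0 (Num.min 1 ((x - a) / (b - a))).
exists (H \o psi); split.
- apply: torus_sequence_comp => //.
  apply: max_fun_continuous; first exact: cst_continuous.
  apply: min_fun_continuous; first exact: cst_continuous.
  move=> x; apply: cvgM; last exact: cvg_cst.
  by apply: cvgB; [exact: cvg_id|exact: cvg_cst].
- move=> k; rewrite /H /= le_max lexx /= ge_max ler01 /= ge_min lexx //.
- move=> k /hA h; rewrite /H /=; apply/max_idPl.
  by rewrite ge_min; apply/orP; right; rewrite pmulr_lle0 ?invr_gt0; lra.
- move=> k /hB h; rewrite /H /=.
  have /min_idPl -> : 1 <= (psi k - a) / (b - a).
    by rewrite ler_pdivlMr; lra.
  by apply/max_idPr.
Qed.

Lemma torus_separatedS (R : realType) (A A' B B' : set nat) :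
  A `<=` A' -> B `<=` B' -> torus_separated R A' B' -> torus_separated R A B.
Proof.
by move=> sA sB [p [tp p01 pA pB]]; exists p; split => // k h;
  [exact/pA/sA|exact/pB/sB].
Qed.

Lemma torus_separatedC (R : realType) (A B : set nat) :
  torus_separated R A B -> torus_separated R B A.
Proof.
move=> [p [tp p01 pA pB]].
apply: (@torus_separated_level _ _ _ (-%R \o p) (-1) 0).
- apply: torus_sequence_comp => //; exact: opp_continuous.
- by lra.
- by move=> k /pB /= ->.
- by move=> k /pA /= ->; rewrite oppr0.
Qed.

Lemma torus_separatedUl (R : realType) (A A' B : set nat) :
  torus_separated R A B -> torus_separated R A' B -> torus_separated R (A `|` A') B.
Proof.
move=> [p [tp p01 pA pB]] [q [tq q01 qA qB]].
apply: (@torus_separated_level _ _ _ (fun k => Num.min (p k) (q k)) 0 1).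
- apply: (@torus_sequence_comp2 R _ _ _ (fun xy : R * R => Num.min xy.1 xy.2)) tp tq.
  exact: min_continuous.
- exact: ltr01.
- by move=> k [/pA ->|/qA ->]; rewrite ge_min lexx ?orbT.
- by move=> k Bk; rewrite pB ?qB// le_min lexx.
Qed.

Lemma torus_separated0 (R : realType) (B : set nat) : torus_separated R set0 B.
Proof.
exists (fun=> 1); split => //; first exact: torus_sequence_cst.
by move=> _; rewrite ler01 lexx.
Qed.

Lemma torus_separated_bigl (R : realType) (m : nat) (A : nat -> set nat) (B : set nat) :
  (forall i, (i < m)%N -> torus_separated R (A i) B) ->
  torus_separated R [set k | exists2 i, (i < m)%N & A i k] B.
Proof.
elim: m => [|m IH] h.
  by apply: torus_separatedS (torus_separated0 R B) => // k [].
apply: (torus_separatedS (A' := [set k | exists2 i, (i < m)%N & A i k] `|` A m)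
  (B' := B)) => //.
- move=> k [l]; rewrite ltnS leq_eqVlt => /orP[/eqP->|lm] Ak; first by right.
  by left; exists l.
- by apply: torus_separatedUl; [apply: IH => i im; apply: h; exact: ltnW|exact: h].
Qed.

Lemma torus_separated_big (R : realType) (m n : nat) (A B : nat -> set nat) :
  (forall i j, (i < m)%N -> (j < n)%N -> torus_separated R (A i) (B j)) ->
  torus_separated R [set k | exists2 i, (i < m)%N & A i k]
    [set k | exists2 j, (j < n)%N & B j k].
Proof.
move=> h; apply: torus_separated_bigl => i im; apply/torus_separatedC.
by apply: torus_separated_bigl => j jn; exact/torus_separatedC/h.
Qed.

(** * Realizing two-step sequences on nilmanifolds *)

Section shear.
Variables (R : realType) (n : nat) (N : 'M[R]_n).

(** The semidirect product of Z and R^n in which m acts by 1 + m N, a unipotent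
matrix as N^2 = 0.  The first factor is Z and not R: the group is then a disjoint
union of copies of R^n on which product and inverse are linear, and, N being an
integer matrix, Z^n-periodic functions of the R^n-component are invariant under
the lattice Z |x Z^n. *)
Definition shear_group (_ : N *m N = 0) : Type :=
  (discrete_topology int * 'rV[R]_n)%type.

Variable NN : N *m N = 0.
Local Notation G := (shear_group NN).

HB.instance Definition _ := Topological.on G.

Definition shear_mul (x y : G) : G :=
  ((x.1 : int) + (y.1 : int), x.2 + y.2 + (x.1 : int)%:~R *: (y.2 *m N)).
Definition shear_inv (x : G) : G :=
  (- (x.1 : int), - x.2 + (x.1 : int)%:~R *: (x.2 *m N)).
Definition shear_one : G := (0 : int, 0).

Lemma mulNN (v : 'rV[R]_n) : v *m N *m N = 0.
Proof. by rewrite -mulmxA NN mulmx0. Qed.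

Fact shear_mulA : associative shear_mul.
Proof.
move=> [a u] [b v] [c w]; congr (_, _) => /=; first by rewrite addrA.
rewrite intrD !mulmxDl -scalemxAl mulNN scaler0 addr0 !scalerDr scalerDl.
rewrite !addrA [in RHS](addrAC (u + v) _ w) -!addrA; do 3!congr (_ + _).
by rewrite addrCA; congr (_ + _); rewrite addrC.
Qed.
Fact shear_mul1 : left_id shear_one shear_mul.
Proof. by move=> [a u]; congr (_, _); rewrite /= ?add0r// scale0r addr0. Qed.
Fact shear_mulr1 : right_id shear_one shear_mul.
Proof. by move=> [a u]; congr (_, _); rewrite /= ?addr0// mul0mx scaler0 addr0. Qed.
Fact shear_mulV : left_inverse shear_one shear_inv shear_mul.
Proof.
move=> [a u]; congr (_, _); rewrite /= ?addNr// mulrNz scaleNr.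
by rewrite (addrAC (- u)) addNr add0r subrr.
Qed.
Fact shear_mulrV : right_inverse shear_one shear_inv shear_mul.
Proof.
move=> [a u]; congr (_, _); rewrite /= ?subrr// mulmxDl mulNmx -scalemxAl mulNN.
by rewrite scaler0 addr0 scalerN addrA subrr add0r subrr.
Qed.

HB.instance Definition _ := isGroup.Build G
  shear_mulA shear_mul1 shear_mulr1 shear_mulV shear_mulrV.
HB.instance Definition _ := GroupTopological.on G.

Lemma shear_mulE (x y : G) : (x * y)%g = shear_mul x y. Proof. by []. Qed.
Lemma shear_invE (x : G) : (x^-1)%g = shear_inv x. Proof. by []. Qed.

Lemma shear_expE (v : 'rV[R]_n) k :
  (((1 : int, v) : G) ^+ k)%g = (k%:Z, unipotent_orbit N v k).
Proof.
elim: k => [|k IH].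
  by rewrite expg0 /unipotent_orbit !scale0r addr0.
rewrite expgS IH shear_mulE /shear_mul /unipotent_orbit /=; congr (_, _).
rewrite scale1r mulmxDl -!scalemxAl mulNN scaler0 addr0 binS bin1 natrD.
rewrite -natr1 !scalerDl scale1r (addrC _ v) -!addrA; congr (_ + (_ + _)).
Qed.

Local Open Scope quotient_scope.

Lemma snd_continuous : continuous (fun x : G => x.2).
Proof. by move=> x; exact: cvg_snd. Qed.

Lemma shear_cvg_pair (T : Type) (F : set_system T) (f : T -> discrete_topology int)
    (g : T -> 'rV[R]_n) (a : discrete_topology int) (b : 'rV[R]_n) :
  Filter F -> f @ F --> a -> g @ F --> b ->
  (fun z => (f z, g z) : G) @ F --> ((a, b) : G).
Proof. by move=> FF fa gb; exact: (cvg_pair fa gb). Qed.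

Lemma near_fst (x : G) : \forall y \near x, (y.1 : int) = x.1.
Proof.
have h : (fun y : G => y.1) @ x --> (x.1 : discrete_topology int) by exact: cvg_fst.
by apply: (h [set x.1]); exact: discrete_set1.
Qed.

Lemma shear_mul_continuous : continuous (fun p : G * G => (p.1 * p.2)%g).
Proof.
move=> [x y].
suff : (fun p : G * G => (((x.1 : int) + (y.1 : int) : discrete_topology int),
    p.1.2 + p.2.2 + (x.1 : int)%:~R *: (p.2.2 *m N)) : G) @ (x, y) --> shear_mul x y.
  apply: cvg_trans; apply: near_eq_cvg; near=> p.
  have p1 : (p.1.1 : int) = x.1 by near: p; apply: (cvg_fst (near_fst x)).
  have p2 : (p.2.1 : int) = y.1 by near: p; apply: (cvg_snd (near_fst y)).
  by rewrite shear_mulE /shear_mul p1 p2.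
apply: shear_cvg_pair; first exact: cvg_cst.
have c1 : (fun p : G * G => p.1.2) @ (x, y) --> x.2.
  by apply: (cvg_comp _ _ cvg_fst); exact: snd_continuous.
have c2 : (fun p : G * G => p.2.2) @ (x, y) --> y.2.
  by apply: (cvg_comp _ _ cvg_snd); exact: snd_continuous.
apply: cvgD; first exact: cvgD.
apply: cvgZ; first exact: cvg_cst.
exact: cvg_mulmx.
Unshelve. all: by end_near. Qed.

Lemma shear_inv_continuous : continuous (fun x : G => (x^-1)%g).
Proof.
move=> x.
suff : (fun y : G => ((- (x.1 : int) : discrete_topology int),
    - y.2 + (x.1 : int)%:~R *: (y.2 *m N)) : G) @ x --> shear_inv x.
  apply: cvg_trans; apply: near_eq_cvg; near=> y.
  have y1 : (y.1 : int) = x.1 by near: y; exact: near_fst.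
  by rewrite shear_invE /shear_inv y1.
apply: shear_cvg_pair; first exact: cvg_cst.
apply: cvgD; first by apply: cvgN; exact: snd_continuous.
apply: cvgZ; first exact: cvg_cst.
by apply: cvg_mulmx; exact: snd_continuous.
Unshelve. all: by end_near. Qed.

Section chart.
Variable m : int.
Let dom : set G := [set x | x.1 = m].
Let inv (v : 'rV[R]_n) : G := (m, v).

Lemma shear_dom_open : open dom.
Proof.
by rewrite openE => x xm; apply: filterS (near_fst x) => y yx; exact: etrans yx xm.
Qed.

Lemma shear_img : (fun x : G => x.2) @` dom = setT.
Proof. by apply/seteqP; split => // v _; exists (m, v). Qed.

Lemma shear_img_open : open ((fun x : G => x.2) @` dom).
Proof. by rewrite shear_img; exact: openT. Qed.

Lemma shear_chartK x : dom x -> inv x.2 = x.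
Proof. by case: x => [k v] xm; congr (_, _); exact: esym xm. Qed.

Lemma shear_chart_cont : {within dom, continuous (fun x : G => x.2)}.
Proof. exact/continuous_subspaceT/snd_continuous. Qed.

Lemma shear_inv_cont : {within (fun x : G => x.2) @` dom, continuous inv}.
Proof.
apply: continuous_subspaceT => v.
have FF : Filter (nbhs v) by exact: nbhs_filter.
apply: (@shear_cvg_pair _ _ (fun=> m) id m v FF); last exact: cvg_id.
exact: cvg_cst.
Qed.

Definition shear_chart : chart R n G := Chart shear_dom_open shear_img_open
  shear_chartK shear_chart_cont shear_inv_cont.
End chart.

(** The charts are the components of the group; a change of charts is the
identity (or has an empty domain), and product and inverse are linear in
charts. *)
Lemma shear_lie : lie_group (range shear_chart).
Proof.
split.
- exact: prod_hausdorff discrete_hausdorff (@norm_hausdorff _ _).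
- exact: second_countable_prod_row.
- exact: shear_mul_continuous.
- exact: shear_inv_continuous.
- by move=> x; exists (shear_chart x.1) => //; exists (x.1 : int).
- move=> _ _ [a _ <-] [b _ <-].
  have -> : chart_map (shear_chart b) \o chart_inv (shear_chart a) = id by [].
  by apply: smooth_on_linear => // x; exact: cvg_id.
- move=> _ _ _ [a _ <-] [b _ <-] [c _ <-].
  pose f (p : 'rV[R]_n * 'rV[R]_n) := p.1 + p.2 + a%:~R *: (p.2 *m N).
  apply: (@smooth_on_linear R _ _ _ f).
    move=> k [u v] [u' v']; rewrite /f /=.
    rewrite mulmxDl -scalemxAl; set p := v *m N; set q := v' *m N.
    by apply/rowP => j; rewrite !mxE; ring.
  move=> [u v]; apply: cvgD; first by apply: cvgD; [exact: cvg_fst|exact: cvg_snd].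
  apply: cvgZ; first exact: cvg_cst.
by apply: cvg_mulmx; exact: cvg_snd.
- move=> _ _ [a _ <-] [b _ <-].
  pose f (u : 'rV[R]_n) := - u + a%:~R *: (u *m N).
  apply: (@smooth_on_linear R _ _ _ f).
    move=> k u v; rewrite /f mulmxDl -scalemxAl.
    by set p := u *m N; set q := v *m N; apply/rowP => j; rewrite !mxE; ring.
  have fc : continuous (fun u : 'rV[R]_n => a%:~R *: (u *m N)).
    by move=> u; exact: (cvgZl_tmp (@mulmx_continuous R n N u)).
  have nc : continuous (fun u : 'rV[R]_n => - u).
    by move=> u; exact: (cvgN (@cvg_id _ (nbhs u))).
  by move=> u; exact: (cvgD (nc u) (fc u)).
Qed.

(** Commutators have Z-component 0 and R^n-component in the image of N, which N
kills; such elements are central. *)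
Lemma shear_nilpotent : nilpotent_of_step 2 G.
Proof.
pose central : set G := [set x | (x.1 : int) = 0 /\ x.2 *m N = 0].
have central_comm (x y : G) : central x -> (x * y = y * x)%g.
  move=> [x1 x2]; rewrite !shear_mulE /shear_mul x1 x2 scale0r scaler0 !addr0.
  by congr (_, _); rewrite ?addr0 ?add0r// addrC.
have comm_central (x y : G) : central [~ x, y]%g.
  have h : [~ x, y]%g.1 = (0 : int).
    rewrite /commg /conjg !shear_mulE !shear_invE /=; lia.
  split; first exact: h.
  rewrite /commg /conjg !shear_mulE !shear_invE /shear_mul /shear_inv /=.
  rewrite !(mulmxDl, mulNmx, =^~ scalemxAl, mulNN, scaler0, addr0, oppr0).
  by rewrite (addrC (x.2 *m N)) addKr addNr.
have sub1 : lower_central (G := G) 1 `<=` central.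
  apply: smallest_sub; last by move=> _ [x [y [_ ->]]].
  split; first by split; rewrite //= mul0mx.
  move=> x y [x1 x2] [y1 y2].
  have -> : (x / y)%g = shear_mul x (shear_inv y) by [].
  rewrite /central /shear_mul /shear_inv /= x1 y1; split => //.
  by rewrite !scale0r !addr0 mulmxDl mulNmx x2 y2 subrr.
apply/seteqP; split.
  apply: smallest_sub; last first.
    move=> _ [x [y [/sub1 cx ->]]] /=; apply/eqP/commgP.
    exact: central_comm.
  by split => // x y /= -> ->; rewrite divgg.
by move=> _ -> H [[H1 _] _].
Qed.

Lemma mulmx_int (v : 'rV[R]_n) : (forall i j, N i j \is a Num.int) ->
  (forall j, v 0 j \is a Num.int) -> forall j, (v *m N) 0 j \is a Num.int.
Proof. by move=> iN vi j; rewrite mxE rpred_sum// => k _; rewrite rpredM. Qed.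

(** The subgroup Z |x Z^n; N has to be an integer matrix for it to be closed under
the product. *)
Definition shear_lattice (_ : forall i j, N i j \is a Num.int) : {pred G} :=
  fun x => [forall j, x.2 0 j \is a Num.int].

Variable iN : forall i j, N i j \is a Num.int.
Local Notation Gamma := (shear_lattice iN).

Lemma shear_latticeP (x : G) : reflect (forall j, x.2 0 j \is a Num.int) (x \in Gamma).
Proof. exact: forallP. Qed.

Fact shear_lattice1 : (1%g : G) \in Gamma.
Proof. by apply/shear_latticeP => j; rewrite mxE. Qed.

Fact shear_latticeM : mulg_closed Gamma.
Proof.
move=> x y /shear_latticeP xi /shear_latticeP yi; apply/shear_latticeP => j.
rewrite /= mxE rpredD//; first by rewrite mxE rpredD.
by rewrite mxE rpredM ?intr_int// mulmx_int.
Qed.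

Fact shear_latticeV : invg_closed Gamma.
Proof.
move=> x /shear_latticeP xi; apply/shear_latticeP => j.
rewrite /= mxE rpredD//; first by rewrite mxE rpredN.
by rewrite mxE rpredM ?intr_int// mulmx_int.
Qed.

Definition shear_lattice_group : groupClosed G := HB.pack Gamma
  (isInvClosed.Build G Gamma shear_latticeV)
  (isMul1Closed.Build G Gamma shear_lattice1)
  (isMulClosed.Build G Gamma shear_latticeM).
Local Notation X := (coset_space shear_lattice_group).

Lemma shear_lattice_discrete (x : G) : x \in Gamma -> isolated [set` Gamma] x.
Proof.
move=> xG; split; first by rewrite inE.
exists [set y : G | (y.1 : int) = x.1 /\ forall j, `|y.2 0 j - x.2 0 j| < 1].
  have nb : nbhs x.2 [set v : 'rV[R]_n | forall j, `|v 0 j - x.2 0 j| < 1].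
    exists (fun _ j => ball (x.2 0 j) 1).
      by move=> i j; rewrite (ord1 i); exact: nbhsx_ballx.
    by move=> w wP j; have := wP 0 j; rewrite -ball_normE /= distrC.
  exact: filterI (near_fst x) (snd_continuous nb).
apply/seteqP; split => [y [[y1 yx] /shear_latticeP yG]|_ ->].
  case: x y xG y1 yx yG => [m v] [m' w] /shear_latticeP /= vi /= -> vw wi.
  congr (_, _); apply/rowP => j; apply/eqP; rewrite -subr_eq0.
  have /intrP[k kE] : w 0 j - v 0 j \is a Num.int by rewrite rpredB.
  have := vw j; rewrite kE -intr_norm -[1]/(1%:~R) ltr_int.
  by rewrite intr_eq0; lia.
by split => //=; split => // j; rewrite subrr normr0.
Qed.

(** Translating by the lattice brings the Z-component to 0 and the R^n-component
into the unit cube. *)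
Lemma shear_cocompact : compact [set: X].
Proof.
have -> : [set: X] = \pi_X @`
    ([set (0 : int) : discrete_topology int] `*`
     [set v : 'rV[R]_n | forall j, (`[0, 1]%classic : set R) (v 0 j)]).
  apply/seteqP; split => // x _; rewrite -[x]reprK.
  case: (repr x : G) => m v.
  pose w : 'rV[R]_n := \row_j (- (Num.floor (v 0 j))%:~R).
  have wi j : w 0 j \is a Num.int by rewrite mxE rpredN intr_int.
  exists (0 : int, v + w).
    split => //= j; rewrite !mxE /= in_itv /=.
    have /andP[h1 h2] := floor_itv (v 0 j); rewrite intrD in h2.
    by apply/andP; split; lra.
  apply/eqmodP; apply/shear_latticeP => j.
  by rewrite /= !scale0r !addr0 opprD (addrC (- v)) addrNK mxE rpredN wi.
apply: continuous_compact.
  exact/continuous_subspaceT/pi_continuous.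
apply: compact_setX; first exact: compact_set1.
apply: (@rV_compact R n (fun=> `[0, 1]%classic)) => _; exact: segment_compact.
Qed.

Lemma shear_basic_nilsequence (psi : nat -> Cplx R) (v : 'rV[R]_n)
    (F : 'rV[R]_n -> Cplx R) :
  continuous F ->
  (forall x z : 'rV[R]_n, (forall j, z 0 j \is a Num.int) -> F (x + z) = F x) ->
  (forall k, psi k = F (unipotent_orbit N v k)) -> basic_nilsequence 2 psi.
Proof.
move=> Fc Fp psiE.
exists n, G, (range shear_chart), shear_lattice_group; split.
- exact: shear_lie.
- exact: shear_nilpotent.
- exact: shear_lattice_discrete.
- exact: shear_cocompact.
have FM (x y : G) : y \in Gamma -> F (x * y)%g.2 = F x.2.
  move=> /shear_latticeP yi; rewrite -(Fp x.2 (y.2 + (x.1 : int)%:~R *: (y.2 *m N))).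
    by rewrite shear_mulE /shear_mul /= addrA.
  by move=> j; rewrite mxE rpredD// mxE rpredM ?intr_int// mulmx_int.
have Fpi (x y : G) : \pi_X x == \pi y -> F x.2 = F y.2.
  move=> /eqP /eqmodP; rewrite /= /same_coset => h.
  by rewrite -(FM x _ h) mulgA mulgV mul1g.
exists ((1 : int, v) : G), (\pi_X 1%g), ((fun x : G => F x.2) \o repr); split.
  apply: repr_comp_continuous; last by move=> x y h; apply/eqP; exact: Fpi.
  move=> x; exact: (@continuous_comp _ _ _ (fun x : G => x.2) F x
    (snd_continuous (x := x)) (Fc _)).
move=> m _; rewrite psiE /coset_act.
set z := (_ * repr _)%g.
have -> : F (unipotent_orbit N v m) = F z.2.
  rewrite /z FM ?shear_expE//.
  have /eqP/eqmodP : \pi_X (1%g : G) == \pi_X (repr (\pi_X (1%g : G))) by rewrite reprK.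
  by rewrite /= /same_coset invg1 mul1g.
by apply: Fpi; rewrite reprK.
Qed.
End shear.

Lemma basic_nilsequence_torus (R : realType) (psi : nat -> Cplx R) :
  torus_sequence R psi -> basic_nilsequence 2 psi.
Proof.
move=> [n [N [v [F [NN iN Fc Fp psiE]]]]].
exact: (shear_basic_nilsequence NN iN Fc Fp psiE).
Qed.

(** * Separating sparse sets *)

(** [sparse_phase] with target 0 on A and 1/2 on B. *)
Lemma torus_separated_sparse (R : realType) (A B : set nat) :
  (forall k, (A `|` B) k -> (0 < k)%N) -> sparse 5 (A `|` B) ->
  A `&` B = set0 -> torus_separated R A B.
Proof.
move=> pos sp AB.
have [a aP] := sparse_phase (fun k => if k \in B then 2^-1 else 0 : R) pos sp.
apply: (@torus_separated_level _ _ _ (fun k => dist_int (k%:R * a + 0)) (8^-1) (3 / 8)).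
- exact: torus_sequence_linear.
- by lra.
- move=> k Ak; have /= := aP k (or_introl Ak); rewrite addr0.
  case: ifP => [/set_mem Bk|_]; last by rewrite subr0.
  by have : (A `&` B) k by []; rewrite AB.
- move=> k Bk; have /= := aP k (or_intror Bk); rewrite mem_set// addr0 => h.
  have := dist_int_triangle (k%:R * a) (- (k%:R * a - 2^-1)).
  by rewrite dist_intN opprB addrC subrK dist_int_half => h2; lra.
Qed.

Definition within5 (a b : nat) : bool := (a < 5 * b)%N && (b < 5 * a)%N.

Definition no_pair_within5 (A B : set nat) := forall a b, A a -> B b -> ~~ within5 a b.

Lemma torus_separated_no_pair (R : realType) (A B : set nat) :
  (forall k, (A `|` B) k -> (0 < k)%N) -> sparse 5 A -> sparse 5 B ->
  no_pair_within5 A B -> torus_separated R A B.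
Proof.
move=> pos sA sB nc; apply: torus_separated_sparse => //; last first.
  rewrite -subset0 => k [Ak Bk]; have := nc k k Ak Bk.
  by have := pos k (or_introl Ak); rewrite /within5; lia.
move=> x y [Ax|Bx] [Ay|By] xy.
- exact: sA.
- by have := nc _ _ Ax By; rewrite /within5; lia.
- by have := nc _ _ Ay Bx; rewrite /within5; lia.
- exact: sB.
Qed.

Lemma sparseS (L : nat) (X Y : set nat) : X `<=` Y -> sparse L Y -> sparse L X.
Proof. by move=> XY h x y /XY Yx /XY Yy; exact: h. Qed.

Lemma sparse_leq (K L : nat) (X : set nat) : (K <= L)%N -> sparse L X -> sparse K X.
Proof.
move=> KL h x y Xx Xy /(h _ _ Xx Xy); apply: leq_trans.
by rewrite leq_mul2r KL orbT.
Qed.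

(** Two elements within a factor 5 of the same b are within a factor 25 of each
other. *)
Lemma within5_unique (A : set nat) (b : nat) : sparse 25 A ->
  forall a a', A a -> A a' -> within5 a b -> within5 a' b -> a = a'.
Proof.
move=> sA a a' Aa Aa'; rewrite /within5.
by case: (ltngtP a a') => // /sA h; [have := h Aa Aa'|have := h Aa' Aa]; lia.
Qed.

Lemma within5C a b : within5 a b = within5 b a.
Proof. by rewrite /within5 andbC. Qed.

(** A is cut into 8 pieces according to the arc of length 1/8 in which phi a lies
modulo 1, and B into 9: an element of B follows the unique element of A matched
to it, or goes to the last piece if it has none.  Matched pairs only occur
between pieces of the same index, and those are separated by the distance of
phi to an end of the corresponding arc. *)
Lemma torus_separated_by_phase (R : realType) (A B : set nat) (phi : nat -> R) :
  (forall k, (A `|` B) k -> (0 < k)%N) -> sparse 25 A -> sparse 25 B ->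
  (forall b, torus_sequence R (fun k => dist_int (phi k + b))) ->
  (forall a b, A a -> B b -> within5 a b -> 3 / 8 <= dist_int (phi a - phi b)) ->
  torus_separated R A B.
Proof.
move=> pos sA sB tphi dphi.
have /choice[arc arcP] : forall k, exists l, (l < 8)%N /\
    dist_int (phi k - l%:R / 8) <= 8^-1.
  move=> k; have := floor_itv (phi k); rewrite intrD => /andP[f1 f2].
  have /andP[] : 0 <= phi k - (Num.floor (phi k))%:~R < 1.
    by rewrite subr_ge0 f1 ltrBlDl f2.
  set y := _ - _ => y0 y1.
  exists (Num.truncn (8 * y)); have := @truncn_itv R (8 * y).
  rewrite mulr_ge0// => /(_ isT) /andP[h1 h2]; split.
    by rewrite -(ltr_nat R); lra.
  apply: le_trans (dist_int_le _ (Num.floor (phi k))) _.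
  rewrite addrAC -/y; set n := Num.truncn _ in h1 h2 *.
  rewrite -[n.+1%:R]natr1 in h2.
  by rewrite ler_norml; apply/andP; split; lra.
pose A' l := [set a | A a /\ arc a = l].
pose B' l := if (l < 8)%N
  then [set b | B b /\ exists a, [/\ A a, within5 a b & arc a = l]]
  else [set b | B b /\ forall a, A a -> ~~ within5 a b].
apply: (torus_separatedS (A' := [set k | exists2 i, (i < 8)%N & A' i k])
                   (B' := [set k | exists2 i, (i < 9)%N & B' i k])).
- by move=> a Aa; exists (arc a) => //; have [] := arcP a.
- move=> b Bb; have [[a [Aa ab]]|h] := pselect (exists a, A a /\ within5 a b).
    exists (arc a); first by have [] := arcP a; lia.
    by rewrite /B'; have [-> _] := arcP a; split => //; exists a.
  exists 8%N; rewrite // /B' ltnn; split=> // a Aa.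
  by apply/negP => ab; apply: h; exists a.
apply: torus_separated_big => i j i8 j9.
have A'A : A' i `<=` A by move=> k [].
have B'B : B' j `<=` B by rewrite /B'; case: ifP => _ k [].
have [ij|ij] := eqVneq i j.
  apply: (@torus_separated_level _ _ _
    (fun k => dist_int (phi k + - (i%:R / 8))) (8^-1) 4^-1).
  - exact: tphi.
  - by lra.
  - by move=> a [Aa <-]; have [] := arcP a.
  - move=> b; rewrite /B' -ij i8 => -[Bb [a [Aa ab ai]]].
    have := dphi a b Aa Bb ab.
    have [_] := arcP a; rewrite ai.
    have := dist_int_triangle (phi a - i%:R / 8) (- (phi b - i%:R / 8)).
    by rewrite dist_intN opprB addrA subrK; lra.
apply: torus_separated_no_pair.
- by move=> k [/A'A|/B'B] ?; apply: pos; [left|right].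
- exact: sparseS A'A (sparse_leq _ sA).
- exact: sparseS B'B (sparse_leq _ sB).
- move=> a b [Aa ai]; rewrite /B'; case: ifP => j8 [Bb h]; last exact: h.
  apply/negP => ab; case: h => a' [Aa' a'b a'j].
  by have e := within5_unique sA Aa Aa' ab a'b; rewrite -ai e a'j eqxx in ij.
Qed.

Definition gap (x y : nat) : nat := ((x - y) + (y - x))%N.

Lemma dist_int_gap (R : realType) (x y : nat) (a : R) :
  dist_int (x%:R * a - y%:R * a) = dist_int ((gap x y)%:R * a).
Proof.
rewrite -mulrBl /gap natrD; have [xy|yx] := leqP x y.
  have /eqP -> : (x - y == 0)%N by [].
  by rewrite add0r natrB// -dist_intN -mulNr opprB.
have /eqP -> : (y - x == 0)%N by rewrite subn_eq0 ltnW.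
by rewrite addr0 natrB// ltnW.
Qed.

(** The differences of p over the matched pairs are sent close to 1/2 modulo 1 by
[sparse_phase]. *)
Lemma torus_separated_by_gaps (R : realType) (A B : set nat) (p : nat -> nat) :
  (forall k, (A `|` B) k -> (0 < k)%N) -> sparse 25 A -> sparse 25 B ->
  (forall a b : R, torus_sequence R (fun k => dist_int ((p k)%:R * a + b))) ->
  (forall a b, A a -> B b -> within5 a b -> p a != p b) ->
  sparse 5 [set d | exists a b, [/\ A a, B b, within5 a b & d = gap (p a) (p b)]] ->
  torus_separated R A B.
Proof.
move=> pos sA sB tp pab sX.
have [|x xP] := sparse_phase (fun=> 2^-1 : R) _ sX.
  by move=> _ [a [b [Aa Bb ab ->]]]; have := pab _ _ Aa Bb ab; rewrite /gap; lia.
apply: (torus_separated_by_phase (phi := fun k => (p k)%:R * x)) => //.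
move=> a b Aa Bb ab; rewrite dist_int_gap.
have := xP (gap (p a) (p b)); set d := gap _ _ => /(_ _)/wrap[|h].
  by exists a, b.
have := dist_int_triangle (d%:R * x) (- (d%:R * x - 2^-1)).
by rewrite dist_intN opprB addrC subrK dist_int_half => h2; lra.
Qed.

(** Matched pairs whose gap is comparable to their elements: up to a constant
factor, the gaps are as sparse as A. *)
Lemma torus_separated_linear (R : realType) (A B : set nat) (h : nat) :
  (forall k, (A `|` B) k -> (0 < k)%N) -> (0 < h)%N ->
  sparse (100 * h) A -> sparse (100 * h) B ->
  (forall a b, A a -> B b -> within5 a b -> (minn a b <= h * gap a b)%N) ->
  torus_separated R A B.
Proof.
move=> pos h0 sA sB abh.
have sA25 : sparse 25 A by apply: sparse_leq sA; lia.
have sB25 : sparse 25 B by apply: sparse_leq sB; lia.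
have key a b a' b' : A a -> B b -> within5 a b -> A a' -> B b' -> within5 a' b' ->
    (a < a')%N -> (5 * gap a b <= gap a' b')%N.
  move=> Aa Bb ab Aa' Bb' ab' aa'.
  have h1 := sA _ _ Aa Aa' aa'; have h2 := abh _ _ Aa' Bb' ab'.
  have h3 : (5 * gap a b <= 20 * a)%N by move: ab; rewrite /within5 /gap; lia.
  have h4 : (a' <= 5 * minn a' b')%N by move: ab'; rewrite /within5; lia.
  by rewrite (leq_trans h3)// -(leq_pmul2l (m := 5 * h)); lia.
apply: (@torus_separated_by_gaps _ _ _ id) => //.
- exact: torus_sequence_linear.
- move=> a b Aa Bb ab; have := abh _ _ Aa Bb ab.
  by have := pos a (or_introl Aa); have := pos b (or_intror Bb); rewrite /gap; lia.
- move=> _ _ [a [b [Aa Bb ab ->]]] [a' [b' [Aa' Bb' ab' ->]]] dd.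
  have [aa'|a'a|e] := ltngtP a a'.
  + exact: key.
  + by have := key _ _ _ _ Aa' Bb' ab' Aa Bb ab a'a; lia.
  + rewrite -e in ab' dd; rewrite within5C in ab; rewrite within5C in ab'.
    by have e' := within5_unique sB25 Bb Bb' ab ab'; rewrite e' ltnn in dd.
Qed.

(** * Separating the disjoint subsets of a shifted lacunary set *)

Definition shift_pair (r t : nat -> nat) (a b n : nat) : Prop :=
  (a = r n /\ b = (r n + t n)%N) \/ (b = r n /\ a = (r n + t n)%N).

Lemma gap_sq_shift_pair (r t : nat -> nat) a b n : shift_pair r t a b n ->
  gap (a ^ 2) (b ^ 2) = (t n * (2 * r n + t n))%N.
Proof. by rewrite /gap; move=> [[-> ->]|[-> ->]]; nia. Qed.

(** For the pairs (r n, r n + t n) the gaps themselves are the t n, which need not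
be sparse, but the gaps of the squares are t n (2 r n + t n), and there the factor
2 r n + t n is comparable to the element of A in the pair. *)
Lemma torus_separated_square (R : realType) (r t : nat -> nat) (A B : set nat) n0 :
  (forall k, (A `|` B) k -> (0 < k)%N) -> sparse 25 A -> sparse 25 B ->
  (forall n, (0 < t n)%N) -> {homo t : m n / (m <= n)%N} ->
  (forall n, (n0 <= n)%N -> (t n <= r n)%N) ->
  (forall m n, (n0 <= m < n)%N -> (r m + t m < r n)%N) ->
  (forall a b, A a -> B b -> within5 a b ->
     exists2 n, (n0 <= n)%N & shift_pair r t a b n) ->
  torus_separated R A B.
Proof.
move=> pos sA sB t0 tm tr rt pairs.
have key a b n a' b' n' : A a -> A a' -> shift_pair r t a b n ->
    shift_pair r t a' b' n' -> (n0 <= n < n')%N ->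
    (5 * gap (a ^ 2) (b ^ 2) <= gap (a' ^ 2) (b' ^ 2))%N.
  move=> Aa Aa' p p' /andP[n0n nn'].
  rewrite (gap_sq_shift_pair p) (gap_sq_shift_pair p') mulnCA.
  apply: leq_mul; first exact/tm/ltnW.
  have h1 : (r n + t n < r n')%N by apply: rt; rewrite n0n.
  have h2 := tr n n0n.
  have h3 : (r n <= a)%N by case: p => -[]; lia.
  have h4 : (a' <= r n' + t n')%N by case: p' => -[]; lia.
  have /(sA _ _ Aa Aa') : (a < a')%N by case: p => -[]; case: p' => -[]; lia.
  by lia.
apply: (@torus_separated_by_gaps _ _ _ (fun k => k ^ 2)%N) => //.
- exact: torus_sequence_square.
- move=> a b Aa Bb ab; have [n _ p] := pairs _ _ Aa Bb ab.
  by have := t0 n; case: p => -[-> ->] ?; rewrite eqn_exp2r//; lia.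
- move=> _ _ [a [b [Aa Bb ab ->]]] [a' [b' [Aa' Bb' ab' ->]]] dd.
  have [n n0n p] := pairs _ _ Aa Bb ab.
  have [n' n0n' p'] := pairs _ _ Aa' Bb' ab'.
  have [nn'|n'n|e] := ltngtP n n'.
  + by apply: (key _ _ n _ _ n'); rewrite ?n0n.
  + have := key _ _ n' _ _ n Aa' Aa p' p; rewrite n0n' n'n => /(_ isT); lia.
  + by move: dd; rewrite (gap_sq_shift_pair p) (gap_sq_shift_pair p') e ltnn.
Qed.

(** Lacunarity and t = o(r) in integer form: r grows by the factor 1 + 1/p, and
from n0 on t n is at most r n / (4p), a quarter of the guaranteed gap between
r n and r n.+1. *)
Section shifted_sequence.
Variables (r t : nat -> nat) (p n0 : nat).
Hypotheses (r_pos : forall n, (0 < r n)%N) (t_pos : forall n, (0 < t n)%N)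
  (t_incr : forall n, (t n < t n.+1)%N) (p_pos : (0 < p)%N)
  (r_growth : forall n, (p.+1 * r n <= p * r n.+1)%N)
  (t_small : forall n, (n0 <= n)%N -> (4 * p * t n <= r n)%N).

Let E : set nat := range r `|` range (fun n => (r n + t n)%N).

Lemma r_mono : {mono r : m n / (m <= n)%N}.
Proof.
apply/leq_mono/(homo_ltn ltn_trans) => n.
by have := r_growth n; have := r_pos n; nia.
Qed.

Lemma t_mono : {mono t : m n / (m <= n)%N}.
Proof. exact/leq_mono/(homo_ltn ltn_trans). Qed.

Lemma shifted_lt m n : (n0 <= m < n)%N -> (r m + t m < r n)%N.
Proof.
move=> /andP[n0m mn]; have h1 := t_small n0m; have h2 := r_growth m.
have : (r m.+1 <= r n)%N by rewrite r_mono.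
by have := r_pos m; nia.
Qed.

(** A growth factor that tends to infinity with i is all that is needed to make
subsequences sparse, so the linear Bernoulli bound suffices. *)
Lemma r_linear_growth n i : ((p + i) * r n <= p * r (n + i))%N.
Proof.
elim: i => [|i IH]; first by rewrite !addn0.
rewrite !addnS -(leq_pmul2l p_pos); have := r_growth (n + i).
rewrite -(leq_pmul2l p_pos) => h.
apply: leq_trans h; have IH' := leq_mul (leqnn p.+1) IH.
move: IH'; set x := r (n + i); set y := r n => IH'; nia.
Qed.

(** Elements of E are comparable to their distance, with the exception of the
pairs (r n, r n + t n).  The summand r n0 + t n0 of the constant bounds the
finitely many elements with small index, whose distance to others is at least
1. *)
Lemma shifted_pairs a b : E a -> E b -> (a < b)%N ->
  (a <= (4 * p + (r n0 + t n0)) * (b - a))%N \/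
  exists2 n, (n0 <= n)%N & a = r n /\ b = (r n + t n)%N.
Proof.
move=> Ea Eb ab; have [aX|aX] := leqP a (r n0 + t n0); first by left; nia.
have big x : E x -> (r n0 + t n0 < x)%N ->
    exists2 n, (n0 < n)%N & x = r n \/ x = (r n + t n)%N.
  move=> Ex xX; have [n xn] : exists n, x = r n \/ x = (r n + t n)%N.
    by case: Ex => -[n _ <-]; exists n; [left|right].
  exists n => //; rewrite ltnNge; apply/negP => nn0.
  have : (r n <= r n0)%N by rewrite r_mono.
  have : (t n <= t n0)%N by rewrite t_mono.
  by case: xn; lia.
have [n n0n an] := big a Ea aX; have [m n0m bm] := big b Eb (ltn_trans aX ab).
have [nm|mn|e] := ltngtP n m.
- left; have h1 := t_small (ltnW n0n); have h2 := r_growth n.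
  have h3 : (r n.+1 <= r m)%N by rewrite r_mono.
  have h4 : (a <= r n + t n)%N by lia.
  have h5 : (r n.+1 <= b)%N by lia.
  have h6 : (4 * (p * a) <= 4 * (p * r n) + r n)%N by nia.
  have h7 : (p * r n + r n <= p * b)%N by nia.
  have h8 : (a <= 2 * r n)%N by nia.
  suff : (a <= 4 * p * (b - a))%N by nia.
  by nia.
- by have := @shifted_lt m n; rewrite mn (ltnW n0m) => /(_ isT); lia.
- rewrite -e in bm; right; exists n; first exact: ltnW.
  by split; lia.
Qed.

(** A splits according to whether the partner in B of an element forms with it a
pair (r n, r n + t n); the first part needs a quadratic phase, the second a
linear one. *)
Lemma torus_separated_shifted_sparse (R : realType) (A B : set nat) :
  let K := (100 * (4 * p + (r n0 + t n0)))%N in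
  A `<=` E -> B `<=` E -> A `&` B = set0 -> sparse K A -> sparse K B ->
  torus_separated R A B.
Proof.
move=> K AE BE AB sA sB; set h := (4 * p + _)%N in K sA sB.
have posE k : E k -> (0 < k)%N.
  by move=> [] [n _ <-]; have := r_pos n; lia.
have pos k : (A `|` B) k -> (0 < k)%N by move=> [/AE|/BE]; exact: posE.
have hp : (0 < h)%N by rewrite /h; nia.
have sA25 : sparse 25 A by apply: sparse_leq sA; rewrite /K; lia.
have sB25 : sparse 25 B by apply: sparse_leq sB; rewrite /K; lia.
pose sq a := exists b,
  [/\ B b, within5 a b & exists2 n, (n0 <= n)%N & shift_pair r t a b n].
apply: (torus_separatedS (A' := (A `&` sq) `|` (A `&` ~` sq)) (B' := B)) => //.
  by rewrite -setIUr setUv setIT.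
have sub1 : A `&` sq `<=` A by move=> ? [].
have sub2 : A `&` ~` sq `<=` A by move=> ? [].
apply: torus_separatedUl.
  apply: (@torus_separated_square _ r t _ _ n0).
  - by move=> k [/sub1|] ?; apply: pos; [left|right].
  - exact: sparseS sub1 sA25.
  - exact: sB25.
  - exact: t_pos.
  - by move=> m n; rewrite t_mono.
  - by move=> n /t_small; nia.
  - exact: shifted_lt.
  - move=> a b [Aa [b' [Bb' ab' n]]] Bb ab.
    rewrite within5C in ab; rewrite within5C in ab'.
    by rewrite (within5_unique sB25 Bb Bb' ab ab').
apply: (@torus_separated_linear _ _ _ h) => //.
- by move=> k [/sub2|] ?; apply: pos; [left|right].
- exact: sparseS sub2 sA.
- move=> a b [Aa nsq] Bb ab.
  have nsp n : (n0 <= n)%N -> ~ shift_pair r t a b n.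
    by move=> n0n sp; apply: nsq; exists b; split => //; exists n.
  have [lab|lba|e] := ltngtP a b.
  + have [hab|[n n0n [ea eb]]] := shifted_pairs (AE _ Aa) (BE _ Bb) lab.
      by move: hab; rewrite -/h /gap => hab; apply: (@leq_trans a); nia.
    by case: (nsp n n0n); left.
  + have [hab|[n n0n [ea eb]]] := shifted_pairs (BE _ Bb) (AE _ Aa) lba.
      by move: hab; rewrite -/h /gap => hab; apply: (@leq_trans b); nia.
    by case: (nsp n n0n); right.
  + by have : (A `&` B) a by [split => //; rewrite e]; rewrite AB.
Qed.

(** E is cut into sparse classes: indices from n0 on are sorted by their residue
modulo a large N, smaller indices form classes of their own, and the shifted and
unshifted sequences are kept apart. *)
Lemma torus_separated_shifted (R : realType) (A B : set nat) :
  A `<=` E -> B `<=` E -> A `&` B = set0 -> torus_separated R A B.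
Proof.
move=> AE BE AB; pose K := (100 * (4 * p + (r n0 + t n0)))%N.
pose N := (2 * K * p)%N.
have N0 : (0 < N)%N by rewrite /N /K; nia.
pose label n := if (n < n0)%N then (n + N)%N else (n %% N)%N.
have labelN n : (label n < N + n0)%N.
  by rewrite /label; case: ifP => h; [lia|have := ltn_pmod n N0; lia].
have labelP m n : label m = label n -> (m < n)%N -> (n0 <= m)%N /\ (m + N <= n)%N.
  rewrite /label; have := ltn_pmod n N0; have := ltn_pmod m N0.
  case: ifP => hm; case: ifP => hn; try lia.
  move=> _ _ mn lmn; split; first lia.
  have /dvdnP[k kE] : (N %| n - m)%N by rewrite -eqn_mod_dvd ?mn// ltnW.
  by case: k kE => [|k] kE; [lia|rewrite mulSn in kE; lia].
(* Class i holds the elements of label [i./2], unshifted for i even, shifted for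
   i odd. *)
pose Cl i : set nat := [set (r n + odd i * t n)%N | n in [set n | label n = i./2]].
have ClE k : E k -> exists2 i, (i < 2 * (N + n0))%N & Cl i k.
  move=> [] [n _ <-]; have := labelN n.
    exists (label n).*2; first lia.
    by exists n; rewrite /= ?doubleK// odd_double mul0n addn0.
  exists (label n).*2.+1; first lia.
  by exists n; rewrite /= ?uphalf_double// odd_double mul1n.
have Clsparse i : sparse K (Cl i).
  move=> _ _ [m mi <-] [n ni <-]; have := labelP m n; rewrite mi ni => /(_ erefl).
  have [mn|nm|->] := ltngtP m n; last lia.
    move=> /(_ isT) [n0m mN] _.
    have h1 := t_small n0m; have h2 := r_linear_growth m N.
    have h3 : (r (m + N) <= r n)%N by rewrite r_mono.
    have h4 : (2 * K * r m <= r (m + N))%N.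
      by rewrite -(leq_pmul2l p_pos); apply: leq_trans h2; rewrite /N; nia.
    have h5 : (t m <= r m)%N by nia.
    by case: (odd i); nia.
  have : (r n <= r m)%N by rewrite r_mono ltnW.
  have : (t n <= t m)%N by rewrite t_mono ltnW.
  by case: (odd i); lia.
pose M := (2 * (N + n0))%N.
apply: (torus_separatedS (A' := [set k | exists2 i, (i < M)%N & (A `&` Cl i) k])
  (B' := [set k | exists2 i, (i < M)%N & (B `&` Cl i) k])).
- by move=> k Ak; have [i iM] := ClE k (AE _ Ak); exists i.
- by move=> k Bk; have [i iM] := ClE k (BE _ Bk); exists i.
apply: torus_separated_big => i j _ _.
apply: torus_separated_shifted_sparse.
- by move=> k [/AE].
- by move=> k [/BE].
- by rewrite setIACA AB set0I.
- by apply: sparseS (Clsparse i) => k [].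
- by apply: sparseS (Clsparse j) => k [].
Qed.
End shifted_sequence.

(** * From separation to interpolation *)

Lemma torus_sequence_comb (R : realType) (f g : nat -> R) (a b : R) :
  torus_sequence R f -> torus_sequence R g ->
  torus_sequence R (fun k => a * f k + b * g k).
Proof.
apply: (@torus_sequence_comp2 R _ _ _ (fun xy : R * R => a * xy.1 + b * xy.2)).
move=> x; apply: cvgD; apply: cvgM; try exact: cvg_cst.
- exact: cvg_fst.
- exact: cvg_snd.
Qed.

(** The Tietze step: separate the points where f <= -M/3 from those where
f >= M/3, and rescale to the values -M/3 and M/3. *)
Lemma torus_approx_third (R : realType) (E : set nat) (f : nat -> R) (M : R) :
  (forall A B, A `<=` E -> B `<=` E -> A `&` B = set0 -> torus_separated R A B) ->
  0 < M -> (forall k, E k -> `|f k| <= M) ->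
  exists g, [/\ torus_sequence R g, forall k, `|g k| <= M / 3 &
     forall k, E k -> `|f k - g k| <= M * (2 / 3)].
Proof.
move=> sep M0 fM.
have [|||p [tp p01 pA pB]] := sep (E `&` [set k | f k <= - (M / 3)])
    (E `&` [set k | M / 3 <= f k]).
- by move=> k [].
- by move=> k [].
- by rewrite -subset0 => k [[_ /= h1] [_ /= h2]]; lra.
exists (fun k => (2 * M / 3) * p k + (- (M / 3)) * 1); split.
- apply: torus_sequence_comb tp _; exact: torus_sequence_cst.
- move=> k; have /andP[h1 h2] := p01 k.
  by rewrite ler_norml; apply/andP; split; nra.
- move=> k Ek; have := fM k Ek; rewrite !ler_norml => /andP[h1 h2].
  have /andP[h3 h4] := p01 k.
  have [l1|l1] := lerP (f k) (- (M / 3)).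
    by rewrite pA//; apply/andP; split; lra.
  have [l2|l2] := lerP (M / 3) (f k).
    by rewrite pB//; apply/andP; split; lra.
  by apply/andP; split; nra.
Qed.

(** Iterating [torus_approx_third] on the successive remainders gives a series of
torus sequences that converges geometrically to an extension of f. *)
Lemma torus_interpolation (R : realType) (E : set nat) (f : nat -> R) (M : R) :
  (forall A B, A `<=` E -> B `<=` E -> A `&` B = set0 -> torus_separated R A B) ->
  0 < M -> (forall k, E k -> `|f k| <= M) ->
  exists (P : nat -> nat -> R) (psi : nat -> R),
    [/\ forall m, torus_sequence R (P m),
        forall m k, `|psi k - P m k| <= M * (2 / 3) ^+ m &
        forall k, E k -> psi k = f k].
Proof.
move=> sep M0 fM; pose eps m : R := M * (2 / 3) ^+ m.
have eps0 m : 0 < eps m by rewrite /eps mulr_gt0// exprn_gt0.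
have epsS m : eps m.+1 = eps m * (2 / 3) by rewrite /eps exprSr; exact: mulrA.
have /choice[g gP] : forall hm : (nat -> R) * nat, exists g : nat -> R,
    (forall k, E k -> `|f k - hm.1 k| <= eps hm.2) ->
    [/\ torus_sequence R g, forall k, `|g k| <= eps hm.2 / 3 &
      forall k, E k -> `|f k - hm.1 k - g k| <= eps hm.2.+1].
  move=> [h m] /=.
  have [H|H] := pselect (forall k, E k -> `|f k - h k| <= eps m); last by exists h => /H.
  have [g [tg g1 g2]] := torus_approx_third sep (eps0 m) H.
  by exists g => _; split => // k Ek; rewrite epsS; exact: g2.
pose P := fix P (m k : nat) : R := if m is m'.+1 then P m' k + g (P m', m') k else 0.
have PP m : torus_sequence R (P m) /\ forall k, E k -> `|f k - P m k| <= eps m.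
  elim: m => [|m [IH1 IH2]].
    split; first exact: torus_sequence_cst.
    by move=> k Ek; rewrite subr0 /eps mulr1; exact: fM.
  have [tg _ g2] := gP (P m, m) IH2; split; last first.
    by move=> k Ek /=; rewrite opprD addrA; exact: g2.
  have := torus_sequence_comb 1 1 IH1 tg.
  by under eq_fun do rewrite !mul1r.
have /choice[psi psiP] : forall k, exists x, forall m, `|x - P m k| <= eps m.
  move=> k; apply: nested_balls => m; first exact: ltW.
  have [_ g1 _] := gP (P m, m) (PP m).2.
  rewrite /= addrAC subrr add0r; apply: le_trans (g1 k) _.
  by rewrite /= epsS; lra.
exists P, psi; split; first by move=> m; have [] := PP m.
  by move=> m k; exact: psiP.
move=> k Ek; apply/eqP; rewrite -subr_eq0 -normr_le0.
have e0 : (fun m => eps m + eps m) @ \oo --> (0 : R).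
  rewrite -[0](addr0 (0 : R)); suff h : eps @ \oo --> (0 : R) by exact: cvgD.
  by rewrite -(mulr0 M); apply: cvgMr; apply: cvg_expr; rewrite ger0_norm; lra.
apply/ler_addgt0Pl => e e_gt0; rewrite addr0; near \oo => m.
have me : eps m + eps m < e by near: m; exact: (cvgr_lt _ e0).
have := psiP k m; have := (PP m).2 k Ek.
have -> : psi k - f k = (psi k - P m k) - (f k - P m k) by ring.
by move=> h1 h2; apply: le_trans (ler_normB _ _) _; lra.
Unshelve. all: by end_near. Qed.

Lemma uniform_limit_ofP (R : realType) (S : set (nat -> Cplx R))
    (psi : nat -> Cplx R) :
  uniform_limit_of S psi ->
  forall e : R, 0 < e -> exists2 p, S p &
    forall k, (0 < k)%N -> `|p k - psi k| <= e%:C%C.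
Proof.
move=> [p [Sp pcvg]] e e0.
have eC : (0 : Cplx R) < e%:C%C by rewrite ltcR.
have : (p @ \oo) [set h : nat -> Cplx R |
    forall k, (0 < k)%N -> ball (psi k) (e%:C%C : Cplx R) (h k)].
  apply: pcvg; apply/uniform_nbhs; exists [set xy | ball xy.1 (e%:C%C : Cplx R) xy.2].
  by split => //; rewrite -entourage_ballE; exists (e%:C%C : Cplx R).
move=> [m _ /(_ m (leqnn m)) h]; exists (p m) => // k /h.
by rewrite -ball_normE /= distrC => /ltW.
Qed.

Lemma uniform_limit_of_ge (R : realType) (S : set (nat -> Cplx R))
    (psi : nat -> Cplx R) (p : nat -> nat -> Cplx R) (w : nat -> R) :
  (forall m, S (p m)) -> w @ \oo --> (0 : R) ->
  (forall m k, `|psi k - p m k| <= (w m)%:C%C) -> uniform_limit_of S psi.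
Proof.
move=> Sp w0 pw; exists p; split => // A /uniform_nbhs[E [entE EA]].
move: entE; rewrite -entourage_ballE => -[e /= e0 eE].
have [e' e'0 ee'] : exists2 e' : R, 0 < e' & e = e'%:C%C.
  move: e e0 {eE} => [a b]; rewrite ltcE /= => /andP[/eqP -> a0]; by exists a.
have : \forall m \near \oo, w m < e' by exact: (cvgr_lt _ w0).
apply: filterS => m wm; apply: EA => k k0 /=; apply: eE => /=.
rewrite -ball_normE /= ee'; apply: le_lt_trans (pw m k) _.
by rewrite ltcR.
Qed.

Lemma normc_le (R : realType) (x y : R) :
  `|(x +i* y)%C : Cplx R| <= (`|x| + `|y|)%:C%C.
Proof.
rewrite normc_def lecR /= -[leRHS]ger0_norm ?addr_ge0// -sqrtr_sqr ler_wsqrtr//.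
rewrite sqrrD !real_normK ?num_real// -addrA lerD2l lerDr.
by rewrite mulrn_wge0// mulr_ge0.
Qed.

Lemma mkcomplex_continuous (R : realType) :
  continuous (fun xy : R * R => (xy.1 +i* xy.2)%C : Cplx R).
Proof.
move=> [x y]; apply/cvgrPdist_le => /= e e0.
have [d d0 ->] : exists2 d : R, 0 < d & e = d%:C%C.
  move: e e0 => [a b]; rewrite ltcE /= => /andP[/eqP -> a0]; by exists a.
near=> z.
have -> : (x +i* y)%C - (z.1 +i* z.2)%C = ((x - z.1) +i* (y - z.2))%C by [].
apply: le_trans (normc_le _ _) _; rewrite lecR.
have z1 : `|x - z.1| <= d / 2.
  by near: z; apply: (@cvgr_dist_le _ _ _ _ _ fst x); [exact: cvg_fst|rewrite divr_gt0].
have z2 : `|y - z.2| <= d / 2.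
  by near: z; apply: (@cvgr_dist_le _ _ _ _ _ snd y); [exact: cvg_snd|rewrite divr_gt0].
by lra.
Unshelve. all: by end_near. Qed.

Lemma complex_torus_interpolation (R : realType) (E : set nat)
    (S : set (nat -> Cplx R)) :
  (forall A B, A `<=` E -> B `<=` E -> A `&` B = set0 -> torus_separated R A B) ->
  (forall psi : nat -> Cplx R, torus_sequence R psi -> S psi) ->
  interpolates (uniform_limit_of S) E.
Proof.
move=> sep tS f [M0 [M0r fM]].
have [M Mpos fM'] : exists2 M : R, 0 < M & forall k, E k -> `|f k| <= M%:C%C.
  have [M M1 MM0] : exists2 M : R, 0 < M & M0 < M%:C%C.
    exists (`|complex.Re M0| + 1); first by rewrite ltr_pwDr.
    move: M0r; rewrite realE !lecE ltcE /= (eq_sym 0) -andb_orr.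
    move=> /andP[/eqP -> _]; rewrite eqxx /=.
    by rewrite (le_lt_trans (ler_norm _))// ltrDl.
  by exists M => // k Ek; exact: (fM _ MM0 k Ek).
have fRe k : E k -> `|complex.Re (f k)| <= M.
  by move=> Ek; rewrite -lecR; apply: le_trans (fM' _ Ek); exact: normc_ge_Re.
have fIm k : E k -> `|complex.Im (f k)| <= M.
  move=> Ek; rewrite -lecR; apply: le_trans (fM' _ Ek).
  by rewrite normc_def lecR -sqrtr_sqr ler_wsqrtr// lerDr sqr_ge0.
have [P [u [tP Pu uE]]] := torus_interpolation sep Mpos fRe.
have [Q [v [tQ Qv vE]]] := torus_interpolation sep Mpos fIm.
exists (fun k => (u k +i* v k)%C); last first.
  by move=> k Ek; rewrite uE// vE//; case: (f k).
apply: (@uniform_limit_of_ge _ _ _ (fun m k => (P m k +i* Q m k)%C)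
  (fun m => M * (2 / 3) ^+ m + M * (2 / 3) ^+ m)).
- move=> m; apply: tS.
  exact: (torus_sequence_comp2 (@mkcomplex_continuous R) (tP m) (tQ m)).
- rewrite -[0](addr0 (0 : R)).
  suff h : (fun m => M * (2 / 3) ^+ m) @ \oo --> (0 : R) by exact: cvgD.
  by rewrite -(mulr0 M); apply: cvgMr; apply: cvg_expr; rewrite ger0_norm; lra.
- move=> m k.
  have -> : (u k +i* v k)%C - (P m k +i* Q m k)%C =
    ((u k - P m k) +i* (v k - Q m k))%C by [].
  by apply: le_trans (normc_le _ _) _; rewrite lecR lerD.
Qed.

(** * Bohr recurrence forbids Bohr almost periodic interpolation *)

Lemma circle0 (R : realType) :
  (0 : circle R) = (\pi_(Quotient.quot (integers R)) 0)%qT.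
Proof. by rewrite /GRing.zero /= /Quotient.zero -lock. Qed.

Lemma circle_mulrn (R : realType) (x : R) n :
  ((\pi_(Quotient.quot (integers R)) x)%qT : circle R) *+ n =
  (\pi_(Quotient.quot (integers R)) (x *+ n))%qT.
Proof.
elim: n => [|n IH]; first by rewrite !mulr0n circle0.
by rewrite !mulrS IH Quotient.pi_add.
Qed.

Lemma dist_int_repr (R : realType) (x : R) :
  dist_int (repr ((\pi_(Quotient.quot (integers R)) x)%qT :
    Quotient.quot (integers R))) = dist_int x.
Proof.
set y := repr _.
have : (\pi_(Quotient.quot (integers R)) y =
        \pi_(Quotient.quot (integers R)) x)%qT by rewrite reprK.
move=> /eqP; rewrite -Quotient.idealrBE => /intrP[m ym].
by rewrite -(dist_intDz x m) -ym addrC subrK.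
Qed.

(** The form in which Bohr recurrence is used: dist_int descends to the circle, so
its small values there form a neighbourhood of 0. *)
Lemma bohr_recurrence_dist_int (R : realType) (A : set nat) d (a : 'I_d -> R) (e : R) :
  bohr_recurrence R A -> 0 < e ->
  exists2 n, A n & forall j, dist_int (n%:R * a j) < e.
Proof.
move=> bohr e0.
pose pi (x : R) : circle R := (\pi_(Quotient.quot (integers R)) x)%qT.
pose U : set (circle R) := [set x | dist_int (repr (x : Quotient.quot (integers R))) < e].
have Uopen : open U.
  rewrite /open /= /quotient_open.
  have -> : (\pi_(quotient_topology (Quotient.quot (integers R))) @^-1` U)%qT =
      @dist_int R @^-1` [set y | y < e].
    by apply/seteqP; split => x /=; rewrite /U /= dist_int_repr.
  apply: open_comp; last exact: open_lt.
  by move=> x _; exact: dist_int_continuous.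
have U0 : nbhs (0 : circle R) U.
  apply: open_nbhs_nbhs; split => //; rewrite /U /=.
  rewrite circle0.
  rewrite dist_int_repr; apply: le_lt_trans (dist_int_le 0 0) _.
  by rewrite subrr normr0.
have [|_ [[n An <-] nU]] := bohr d (\row_j pi (a j)) [set v | forall j, U (v 0 j)].
  exists (fun _ j => U); first by move=> i j; rewrite mxE.
  by move=> v vU j; exact: vU.
exists n => // j; have := nU j.
by rewrite /U /= mulmxnE mxE circle_mulrn dist_int_repr mulr_natl.
Qed.

Section exponential.
Variable R : realType.
Local Notation e := (@cexp2pi R).

Lemma cexp2piD (x y : R) : e (x + y) = e x * e y.
Proof.
rewrite /cexp2pi mulrDr cosD sinD; apply/eqP; rewrite eq_complex /=.
by rewrite eqxx /= addrC mulrC (mulrC (sin _)) eqxx.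
Qed.

Lemma cexp2pi0 : e 0 = 1.
Proof. by rewrite /cexp2pi mulr0 cos0 sin0. Qed.

Lemma cexp2pi_int (m : int) : e m%:~R = 1.
Proof.
have en (k : nat) : e k%:R = 1.
  elim: k => [|k IH]; first exact: cexp2pi0.
  rewrite -natr1 cexp2piD IH mul1r /cexp2pi mulr1 mulr_natl cos2pi.
  by rewrite mulr2n sinD sinpi cospi !mul0r !mulr0 addr0.
case: m => k; first exact: en.
have := cexp2piD (k.+1%:R) (Negz k)%:~R.
by rewrite NegzE mulrNz subrr cexp2pi0 en mul1r.
Qed.

Lemma norm_cexp2pi (x : R) : `|e x| = 1.
Proof. by rewrite /cexp2pi normc_def /= cos2Dsin2 sqrtr1. Qed.

Lemma cexp2pi_continuous : continuous e.
Proof.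
have lc : continuous (fun x : R => 2 * trigo.pi * x).
  by move=> x; exact: (cvgZl_tmp (@cvg_id _ (nbhs x))).
have cc : continuous (fun x : R => cos (2 * trigo.pi * x)).
  by move=> x; exact: continuous_comp (lc x) (@continuous_cos R _).
have sc : continuous (fun x : R => sin (2 * trigo.pi * x)).
  by move=> x; exact: continuous_comp (lc x) (@continuous_sin R _).
move=> x.
have h : continuous (fun x : R =>
    (cos (2 * trigo.pi * x), sin (2 * trigo.pi * x)) : R * R).
  exact: pair_continuous.
have := @continuous_comp _ _ _ _ _ x (h x) (@mkcomplex_continuous R _); exact.
Qed.

Lemma cexp2pi_near1 (d : R) : 0 < d ->
  exists2 eta : R, 0 < eta & forall x, dist_int x < eta -> `|e x - 1| <= d%:C%C.
Proof.
move=> d0.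
have dC : (0 : Cplx R) < d%:C%C by rewrite ltcR.
have : \forall x \near (0 : R), `|e 0 - e x| <= d%:C%C.
  by have /cvgrPdist_le := @cexp2pi_continuous 0; exact.
move=> /nbhs_ballP[eta /= eta0 H]; exists eta => // x xeta.
set m := Num.floor (x + 2^-1).
have -> : x = (x - m%:~R) + m%:~R by rewrite subrK.
rewrite cexp2piD cexp2pi_int mulr1 distrC -cexp2pi0; apply: H.
by rewrite -ball_normE /= sub0r normrN.
Qed.

(** A trigonometric polynomial almost has period t as soon as t a is almost an
integer for each of its finitely many frequencies a. *)
Lemma trig_poly_near_period (p : nat -> Cplx R) (d : R) : trig_poly p -> 0 < d ->
  exists k (a : 'I_k -> R) eta, 0 < eta /\ forall n t, (0 < n)%N ->
    (forall j, dist_int (t%:R * a j) < eta) -> `|p (n + t)%N - p n| <= d%:C%C.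
Proof.
move=> [k [c [a pE]]] d0; pose C := \sum_j complex.Re `|c j|.
have Cc j : `|c j| = (complex.Re `|c j|)%:C%C by rewrite normc_def.
have c0 j : 0 <= complex.Re `|c j| by rewrite -lecR -Cc; exact: normr_ge0.
have C0 : 0 <= C by apply: sumr_ge0.
have C1 : 0 < C + 1 by lra.
have [|eta eta0 H] := @cexp2pi_near1 (d / (C + 1)); first by rewrite divr_gt0.
exists k, a, eta; split => // n t n0 ta.
rewrite !pE ?addn_gt0 ?n0// -sumrB.
apply: le_trans (ler_norm_sum _ _ _) _.
apply: (@le_trans _ _ (\sum_j (complex.Re `|c j| * (d / (C + 1)))%:C%C)).
  apply: ler_sum => j _; rewrite natrD mulrDl cexp2piD.
  have -> : c j * (e (n%:R * a j) * e (t%:R * a j)) - c j * e (n%:R * a j) =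
    c j * (e (n%:R * a j) * (e (t%:R * a j) - 1)) by ring.
  rewrite !normrM norm_cexp2pi mul1r rmorphM /= -Cc.
  by apply: ler_wpM2l => //; exact: H.
rewrite -rmorph_sum lecR -mulr_suml -/C mulrA ler_pdivrMr// mulrC.
by rewrite ler_wpM2l//; lra.
Qed.
End exponential.

Lemma not_I0_shifted (R : realType) (r t : nat -> nat) (n0 : nat) :
  (forall n, (0 < r n)%N) -> (forall n, (0 < t n)%N) ->
  (forall n, (n0 <= n)%N -> forall m, (r n + t n)%N <> r m) ->
  bohr_recurrence R (range t) ->
  ~ I0_set R (range r `|` range (fun n => (r n + t n)%N)).
Proof.
move=> r0 t0 rt bohr I0.
pose f (x : nat) : Cplx R := if `[< range r x >] then 1 else 0.
have [|psi bap psiE] := I0 f.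
  exists 1; split => // M M1 x _ /=.
  by apply: le_trans (ltW M1); rewrite /f; case: ifP; rewrite ?normr1 ?normr0.
have q0 : 0 < 4^-1 :> R by lra.
have [p tp pP] := uniform_limit_ofP bap q0.
have [k [a [eta [eta0 H]]]] := trig_poly_near_period tp q0.
(* The frequencies 1/(2 t i), i < n0, exclude the indices below n0, because
   t i / (2 t i) = 1/2 is at distance 1/2 from the integers. *)
pose a' (j : 'I_(k + n0)) : R := match fintype.split j with
  | inl i => a i | inr i => (2 * (t i)%:R)^-1 end.
have [|_ [n _ <-] nP] := @bohr_recurrence_dist_int R _ _ a' (Num.min eta 2^-1) bohr.
  by rewrite lt_min eta0; lra.
have n0n : (n0 <= n)%N.
  rewrite leqNgt; apply/negP => nn0.
  have := nP (rshift k (Ordinal nn0)).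
  rewrite /a' -[rshift _ _]/(unsplit (inr _)) unsplitK /= invfM mulrCA divff; last first.
    by rewrite pnatr_eq0 -lt0n t0.
  by rewrite mulr1 dist_int_half lt_min ltxx andbF.
have h1 : `|p (r n + t n)%N - p (r n)| <= (4^-1)%:C%C.
  apply: H => // j; have := nP (lshift n0 j).
  by rewrite /a' -[lshift _ _]/(unsplit (inl _)) unsplitK lt_min => /andP[].
have h2 := pP (r n) (r0 n); have h3 := pP (r n + t n)%N (ltn_addr _ (r0 n)).
have e1 : psi (r n) = 1.
  by rewrite psiE; [rewrite /f asboolT//; exists n|left; exists n].
have e2 : psi (r n + t n)%N = 0.
  rewrite psiE; last by right; exists n.
  by rewrite /f asboolF// => -[m _ /esym]; exact: rt.
rewrite e1 in h2; rewrite e2 subr0 in h3.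
have : `|1 : Cplx R| <= (4^-1 + 4^-1 + 4^-1)%:C%C.
  have -> : 1 = p (r n + t n)%N - (p (r n + t n)%N - p (r n)) - (p (r n) - 1) by ring.
  rewrite !rmorphD; apply: le_trans (ler_normB _ _) _; apply: lerD => //.
  by apply: le_trans (ler_normB _ _) _; apply: lerD.
by rewrite normr1 -[1]/(1%:C%C) lecR; lra.
Qed.

Lemma lacunary_growth (R : realType) (r : nat -> nat) :
  (forall n, (0 < r n)%N) -> lacunary R r ->
  exists2 p, (0 < p)%N & forall n, (p.+1 * r n <= p * r n.+1)%N.
Proof.
move=> r0 [_ lac]; set q := inf _ in lac.
have qr n : q * (r n)%:R <= (r n.+1)%:R.
  rewrite -ler_pdivlMr ?ltr0n//; apply: ge_inf; last by exists n.
  by exists 0 => _ [m _ <-]; rewrite divr_ge0.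
have q1 : 0 < q - 1 by lra.
pose p := (Num.truncn (q - 1)^-1).+1.
have pq : 1 <= p%:R * (q - 1).
  by rewrite -ler_pdivrMr// div1r ltW// truncnS_gt.
exists p => // n; rewrite -(ler_nat R) !natrM -natr1.
have h1 := qr n; have h2 : 0 <= (r n)%:R :> R by [].
have h3 : p%:R * (q * (r n)%:R) <= p%:R * (r n.+1)%:R by rewrite ler_wpM2l.
by nra.
Qed.

Theorem corollary1p5 (R : realType) (r t : nat -> nat)
    (r_pos : forall n, (0 < r n)%N) (r_lac : lacunary R r)
    (t_pos : forall n, (0 < t n)%N) (t_incr : forall n, (t n < t n.+1)%N)
    (t_small : (fun n => (t n)%:R / (r n)%:R : R) @ \oo --> (0 : R))
    (t_bohr : bohr_recurrence R (range t)) :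
  interpolation_set R 2 (range r `|` range (fun n => (r n + t n)%N)) /\
  ~ I0_set R (range r `|` range (fun n => (r n + t n)%N)).
Proof.
have [p p_pos r_growth] := lacunary_growth r_pos r_lac.
have [n0 small] : exists n0, forall n, (n0 <= n)%N -> (4 * p * t n <= r n)%N.
  have e0 : 0 < ((4 * p)%N%:R)^-1 :> R by rewrite invr_gt0 ltr0n; lia.
  have [n0 _ H] := cvgr_lt _ t_small _ e0; exists n0 => n /H /=.
  rewrite ltr_pdivrMr ?ltr0n// mulrC ltr_pdivlMr; last by rewrite ltr0n; lia.
  by rewrite -natrM ltr_nat mulnC => /ltnW.
split.
  apply: complex_torus_interpolation; last exact: basic_nilsequence_torus.
  exact: (torus_separated_shifted r_pos t_pos t_incr p_pos r_growth small).
apply: (not_I0_shifted (n0 := n0)) => // n n0n m.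
have [nm|mn] := ltnP n m.
  have := shifted_lt r_pos p_pos r_growth small.
  move=> /(_ n m); rewrite n0n nm => /(_ isT).
  by lia.
have : (r m <= r n)%N by rewrite (r_mono r_pos p_pos r_growth).
by have := t_pos n; lia.
Qed.
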